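(* Let $\phi:\mathbb{C}_0\to\mathbb{C}$ be a non-constant analytic function of the form $\phi(s)=c_0s+\varphi(s)$ with $c_0\in\mathbb{N}_0$ and $\varphi\in\mathcal{D}$. For a positive integer $n$ write $n^{-\phi}$ for the function $s\mapsto n^{-\phi(s)}=\exp(-\phi(s)\log n)$. Then: (a)(i) If $\phi(\mathbb{C}_0)\subseteq\overline{\mathbb{C}_0}$ and $f\circ\phi\in\mathcal{A}^+$ for every $f\in\mathcal{A}^+$ (i.e. $C_\phi f=f\circ\phi$ maps $\mathcal{A}^+$ into itself), then $n^{-\phi}\in\mathcal{A}^+$ for every $n\ge1$ and there is a constant $C>0$ independent of $n$ with $\|n^{-\phi}\|_{\mathcal{A}^+}\le C$ for $n=1,2,\dots$. (ii) Conversely, if $n^{-\phi}\in\mathcal{A}^+$ for all $n\ge1$ and $(n^{-\phi})_{n\ge1}$ is a bounded sequence in $\mathcal{A}^+$, then $\phi$ maps $\mathbb{C}_0$ into $\mathbb{C}_0$ and $C_\phi$ is a bounded composition operator on $\mathcal{A}^+$. (b)(i) $C_\phi$ maps $\mathcal{A}^+$ into itself and is a compact operator $\mathcal{A}^+\to\mathcal{A}^+$ if and only if $n^{-\phi}\in\mathcal{A}^+$ for all $n$ and $\|n^{-\phi}\|_{\mathcal{A}^+}\to0$ as $n\to\infty$. In that case, $\phi(\mathbb{C}_0)\subseteq\mathbb{C}_\delta$ for some $\delta>0$. (ii) Assume that $\phi(s)=c_0s+\sum_{n\ge1}c_n n^{-s}$ with $\sum_{n\ge1}|c_n|<+\infty$.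 Then $C_\phi$ is a compact operator on $\mathcal{A}^+$ if and only if $\phi(\mathbb{C}_0)\subseteq\mathbb{C}_\delta$ for some $\delta>0$.
   Context: For $\theta\in\mathbb{R}$, $\mathbb{C}_\theta=\{s\in\mathbb{C}:\operatorname{Re}s>\theta\}$. The Wiener–Dirichlet algebra $\mathcal{A}^+$ is the set of functions $f(s)=\sum_{n\ge1}a_n n^{-s}$ with $\|f\|_{\mathcal{A}^+}=\sum_{n\ge1}|a_n|<\infty$, viewed as functions on $\{\operatorname{Re}s\ge0\}$ (where the series converge absolutely); it is a commutative unital Banach algebra under pointwise multiplication. $\mathcal{D}$ denotes the space of analytic functions $\mathbb{C}_0\to\mathbb{C}$ representable by a convergent Dirichlet series $\sum_{n\ge1}c_n n^{-s}$ for $\operatorname{Re}s$ large enough. $\mathbb{N}_0=\{0,1,2,\dots\}$. The composition operator is $C_\phi f=f\circ\phi$. *)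

(* Defs.v *)
From Stdlib Require Import Reals.
From Coquelicot Require Import Coquelicot.
Open Scope R_scope.

Definition cexp (z : C) : C :=
  (exp (Re z) * cos (Im z), exp (Re z) * sin (Im z)).

Definition npow (n : nat) (w : C) : C :=
  cexp (Copp (Cmult w (RtoC (ln (INR n))))).

Definition Cis_series (u : nat -> C) (l : C) : Prop :=
  is_series (fun k => Re (u k)) (Re l) /\ is_series (fun k => Im (u k)) (Im l).

Definition CSeries (u : nat -> C) : C :=
  (Series (fun k => Re (u k)), Series (fun k => Im (u k))).

(* Coefficient sequences are indexed by k : nat, standing for n = k+1:
   a k is the coefficient of (k+1)^{-s}. *)
Definition dterm (a : nat -> C) (s : C) (k : nat) : C :=
  Cmult (a k) (npow (S k) s).

Definition Dir (a : nat -> C) (s : C) : C := CSeries (dterm a s).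

Definition l1 (a : nat -> C) : Prop := ex_series (fun k => Cmod (a k)).
Definition l1norm (a : nat -> C) : R := Series (fun k => Cmod (a k)).

Definition Ap_rep (a : nat -> C) (f : C -> C) : Prop :=
  l1 a /\ forall s : C, 0 < Re s -> f s = Dir a s.

Definition inAp (f : C -> C) : Prop := exists a, Ap_rep a f.

(* the A^+ norm of f : the l^1 norm of its (unique) coefficient sequence *)
Definition Apnorm (f : C -> C) : R :=
  real (Glb_Rbar (fun r => exists a, Ap_rep a f /\ r = l1norm a)).

Definition analytic_C0 (f : C -> C) : Prop :=
  forall s : C, 0 < Re s -> ex_derive f s.

Definition inD (f : C -> C) : Prop :=
  analytic_C0 f /\
  exists (c : nat -> C) (sigma0 : R),
    forall s : C, sigma0 < Re s -> Cis_series (dterm c s) (f s).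

Definition symbol (phi : C -> C) (c0 : nat) : Prop :=
  analytic_C0 phi /\
  (exists s1 s2 : C, 0 < Re s1 /\ 0 < Re s2 /\ phi s1 <> phi s2) /\
  exists varphi : C -> C, inD varphi /\
    forall s : C, 0 < Re s -> phi s = Cplus (Cmult (RtoC (INR c0)) s) (varphi s).

Definition Ccomp (phi : C -> C) (a : nat -> C) : C -> C := fun s => Dir a (phi s).

(* C_phi maps A^+ into itself: f o phi is defined for every f in A^+
   (phi(C_0) lies in the closed half-plane where such f live) and lies in A^+ *)
Definition comp_maps (phi : C -> C) : Prop :=
  (forall s : C, 0 < Re s -> 0 <= Re (phi s)) /\
  forall a, l1 a -> inAp (Ccomp phi a).

Definition comp_bounded (phi : C -> C) : Prop :=
  comp_maps phi /\
  exists M : R, forall a, l1 a -> Apnorm (Ccomp phi a) <= M * l1norm a.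

Definition comp_compact (phi : C -> C) : Prop :=
  comp_maps phi /\
  forall (A : nat -> nat -> C),
    (forall j, l1 (A j)) -> (exists B : R, forall j, l1norm (A j) <= B) ->
    exists (sigma : nat -> nat) (b : nat -> C),
      (forall j, (sigma j < sigma (S j))%nat) /\ l1 b /\
      is_lim_seq (fun j => Apnorm (fun s => Cminus (Ccomp phi (A (sigma j)) s) (Dir b s))) 0.

Definition npow_phi (phi : C -> C) (n : nat) : C -> C := fun s => npow n (phi s).

(* Main.v *)
Require Import Defs.
From Stdlib Require Import Reals Lra Lia ZArith ClassicalEpsilon
  FunctionalExtensionality List.
From Coquelicot Require Import Coquelicot.
Open Scope R_scope.

(** If [sum |al_n| ||g_n||] converges in A^+, then [sum al_n g_n] is in A^+ (Fubini), which gives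
    products, exponentials and the operator [f -> f o phi] once the functions [n^-phi] are
    bounded.  Bohr's inequality [|a_n| n^-x <= sup_t |f (x + i t)|] gives uniqueness of the
    coefficients and makes each coefficient of [f o phi] a continuous functional of [f], so that
    uniform boundedness applies in (a)(i).  For strict positivity in (a)(ii), the powers of
    [F = 2^-phi] are bounded in A^+; if the constant coefficient of [F] has modulus less than 1,
    then [|F| <= rho < 1] on a line far to the right, so the coefficients of [F^k] of bounded
    index tend to zero, hence [F^k] tends to zero at every point and [|F| < 1]; otherwise [F] is
    constant.  If [Re phi] vanishes somewhere, both [2^-phi] and [3^-phi] are thus constant, hence
    so is [phi].  For (b)(ii), put [t = ln n] and replace [c] by a Dirichlet polynomial [p] up to
    an error [delta / 4]: the exponential series of [- t p], cut at order [O(t)], has a number of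
    coefficients polynomial in [t], each of size [O(exp (- 3 t delta / 4))] by Bohr's inequality,
    so [||n^-phi||] is [O(n^(- delta / 4))]. *)

(** Membership in A^+ is expressed by coefficients valid on the open half-plane only, so coefficient
    estimates come from lines [Re s = x > 0] and reach the boundary as [x] tends to zero. A factor
    [exp (k * Re s)] disappears in this limit, which is how the unbounded part [c0 s] of the symbol
    is tolerated.

    The hypothesis of (a)(i) gives coefficients for each [f o phi] but no bound on them, hence the
    recourse to uniform boundedness; Bohr's inequality supplies the coordinatewise bound 1 that the
    argument needs.

    In (a)(ii), the powers of [q^-phi] are bounded because they are the functions [(q^k)^-phi] of
    the given family. Two bases occur because [2^-phi] determines [Im phi] only modulo
    [2 pi / ln 2]; the independence of [ln 2] and [ln 3] removes the ambiguity.

    In (b)(ii), the direct bound [exp (t ||p||)] grows like a power of [n]. Counting coefficients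
    helps because the exponent [N] in the count [(K+1)^N] does not depend on [n], so that the count
    is absorbed by an arbitrarily small power of [n]. *)

(** * Real series and interchange of summations *)

Lemma is_series_lim_seq (u : nat -> R) (l : R) :
  is_series u l <-> is_lim_seq (sum_f_R0 u) l.
Proof.
  split; intro H.
  - apply is_lim_seq_ext with (sum_n u); [intro n; apply sum_n_Reals | exact H].
  - apply (is_lim_seq_ext _ (sum_n u)) in H; [exact H | intro n; symmetry; apply sum_n_Reals].
Qed.

Lemma Series_nonneg_bound (u : nat -> R) (M : R) :
  (forall n, 0 <= u n) -> (forall N, sum_f_R0 u N <= M) ->
  ex_series u /\ Series u <= M.
Proof.
  intros Hu HM.
  assert (E : ex_finite_lim_seq (sum_f_R0 u)).
  { apply ex_finite_lim_seq_incr with M; auto.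
    intro n; simpl; specialize (Hu (S n)); lra. }
  destruct E as [l Hl].
  assert (S := proj2 (is_series_lim_seq u l) Hl).
  split; [exists l; exact S|].
  rewrite (is_series_unique _ _ S).
  apply (is_lim_seq_le _ _ l M HM Hl (is_lim_seq_const M)).
Qed.

Lemma sum_le_Series (u : nat -> R) (N : nat) :
  (forall n, 0 <= u n) -> ex_series u -> sum_f_R0 u N <= Series u.
Proof.
  intros Hu Hex.
  assert (Hl := proj1 (is_series_lim_seq _ _) (Series_correct _ Hex)).
  apply (is_lim_seq_incr_compare _ _ Hl).
  intro n; simpl; specialize (Hu (S n)); lra.
Qed.

Lemma term_le_Series (u : nat -> R) (n : nat) :
  (forall n, 0 <= u n) -> ex_series u -> u n <= Series u.
Proof.
  intros Hu Hex. apply Rle_trans with (sum_f_R0 u n); [|now apply sum_le_Series].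
  destruct n; simpl; [lra|].
  assert (0 <= sum_f_R0 u n) by (apply cond_pos_sum; auto). lra.
Qed.

Lemma Series_nonneg (u : nat -> R) :
  (forall n, 0 <= u n) -> ex_series u -> 0 <= Series u.
Proof.
  intros Hu Hex. apply Rle_trans with (u 0%nat); auto. now apply term_le_Series.
Qed.

Lemma ex_series_le_R (u v : nat -> R) :
  (forall n, Rabs (u n) <= v n) -> ex_series v -> ex_series u.
Proof. intros H. apply (@ex_series_le R_AbsRing R_CompleteNormedModule). exact H. Qed.

Lemma sum_f_R0_Series (u : nat -> nat -> R) (M : nat) :
  (forall m, ex_series (fun n => u n m)) ->
  ex_series (fun n => sum_f_R0 (u n) M) /\
  Series (fun n => sum_f_R0 (u n) M) = sum_f_R0 (fun m => Series (fun n => u n m)) M.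
Proof.
  intro H. induction M as [|M [IH1 IH2]]; simpl.
  - split; [apply H | reflexivity].
  - split.
    + apply (ex_series_plus (V := R_NormedModule) _ _ IH1 (H (S M))).
    + rewrite Series_plus; auto. now rewrite IH2.
Qed.

Lemma fubini_nonneg (u : nat -> nat -> R) :
  (forall n m, 0 <= u n m) ->
  (forall n, ex_series (u n)) -> ex_series (fun n => Series (u n)) ->
  (forall m, ex_series (fun n => u n m)) /\
  ex_series (fun m => Series (fun n => u n m)) /\
  Series (fun m => Series (fun n => u n m)) <= Series (fun n => Series (u n)).
Proof.
  intros Hp H1 H2.
  assert (Hc : forall m, ex_series (fun n => u n m)).
  { intro m. apply ex_series_le_R with (2 := H2).
    intro n. rewrite Rabs_pos_eq; auto. now apply term_le_Series. }
  split; auto.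
  apply Series_nonneg_bound.
  - intro m. apply Series_nonneg; auto.
  - intro M. destruct (sum_f_R0_Series u M Hc) as [E <-].
    apply Series_le; auto. intro n; split.
    + apply cond_pos_sum; auto.
    + now apply sum_le_Series.
Qed.

(** The one-sided inequality is applied twice, the second time with the indices exchanged. *)
Lemma fubini_nonneg_eq (u : nat -> nat -> R) :
  (forall n m, 0 <= u n m) ->
  (forall n, ex_series (u n)) -> ex_series (fun n => Series (u n)) ->
  Series (fun m => Series (fun n => u n m)) = Series (fun n => Series (u n)).
Proof.
  intros Hp H1 H2.
  destruct (fubini_nonneg u Hp H1 H2) as (A & B & Cc).
  destruct (fubini_nonneg (fun m n => u n m) (fun m n => Hp n m) A B) as (_ & _ & D).
  apply Rle_antisym; auto.
Qed.

(** Reduced to nonnegative arrays by writing [u] as the difference of [|u| + u] and [|u|]. *)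
Lemma fubini (u : nat -> nat -> R) :
  (forall n, ex_series (fun m => Rabs (u n m))) ->
  ex_series (fun n => Series (fun m => Rabs (u n m))) ->
  Series (fun m => Series (fun n => u n m)) = Series (fun n => Series (u n)).
Proof.
  intros H1 H2.
  set (v := fun n m => Rabs (u n m)).
  set (w := fun n m => Rabs (u n m) + u n m).
  assert (Hw : forall n m, 0 <= w n m <= 2 * v n m).
  { intros n m. unfold w, v. split_Rabs; lra. }
  assert (Hu1 : forall n, ex_series (u n)) by (intro n; now apply ex_series_Rabs).
  assert (Hw1 : forall n, ex_series (w n)).
  { intro n. apply (ex_series_plus (V := R_NormedModule) _ _ (H1 n) (Hu1 n)). }
  assert (Hw2 : ex_series (fun n => Series (w n))).
  { apply ex_series_le_R with (fun n => 2 * Series (v n)).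
    - intro n. rewrite Rabs_pos_eq.
      + rewrite <- Series_scal_l. apply Series_le; [apply Hw|].
        apply (ex_series_scal_l (V := R_NormedModule) 2 _ (H1 n)).
      + apply Series_nonneg; auto. intro; apply Hw.
    - apply (ex_series_scal_l (V := R_NormedModule) 2 _ H2). }
  assert (Hv : forall n m, 0 <= v n m) by (intros; apply Rabs_pos).
  destruct (fubini_nonneg v Hv H1 H2) as (Av & Bv & _).
  destruct (fubini_nonneg w (fun n m => proj1 (Hw n m)) Hw1 Hw2) as (Aw & Bw & _).
  assert (Ev := fubini_nonneg_eq v Hv H1 H2).
  assert (Ew := fubini_nonneg_eq w (fun n m => proj1 (Hw n m)) Hw1 Hw2).
  assert (U : forall n m, u n m = w n m - v n m) by (intros; unfold w, v; ring).
  transitivity (Series (fun m => Series (fun n => w n m) - Series (fun n => v n m))).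
  { apply Series_ext; intro m. rewrite <- Series_minus; auto.
    apply Series_ext; auto. }
  rewrite Series_minus; auto. rewrite Ev, Ew, <- Series_minus; auto.
  apply Series_ext; intro n. rewrite <- Series_minus; auto; [|apply H1].
  apply Series_ext; auto.
Qed.

(** * Absolutely summable complex sequences *)

Lemma l1_le (u : nat -> C) (v : nat -> R) :
  (forall n, Cmod (u n) <= v n) -> ex_series v -> l1 u /\ l1norm u <= Series v.
Proof.
  intros H Hv. split.
  - apply ex_series_le_R with v; auto. intro n. rewrite Rabs_pos_eq; auto. apply Cmod_ge_0.
  - apply Series_le; auto. intro n; split; auto; apply Cmod_ge_0.
Qed.

Lemma l1norm_nonneg (u : nat -> C) : l1 u -> 0 <= l1norm u.
Proof. intro H. apply Series_nonneg; auto. intro; apply Cmod_ge_0. Qed.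

Lemma Cmod_le_l1norm (u : nat -> C) (n : nat) : l1 u -> Cmod (u n) <= l1norm u.
Proof. intro H. apply (term_le_Series (fun k => Cmod (u k))); auto. intro; apply Cmod_ge_0. Qed.

Lemma im_le_Cmod (c : C) : Rabs (Im c) <= Cmod c.
Proof.
  apply Rle_trans with (2 := Rmax_Cmod c). apply Rmax_r.
Qed.

Lemma l1_re_abs (u : nat -> C) : l1 u -> ex_series (fun k => Rabs (Re (u k))).
Proof.
  intro H. apply ex_series_le_R with (2 := H). intro n. rewrite Rabs_Rabsolu. apply re_le_Cmod.
Qed.

Lemma l1_im_abs (u : nat -> C) : l1 u -> ex_series (fun k => Rabs (Im (u k))).
Proof.
  intro H. apply ex_series_le_R with (2 := H). intro n. rewrite Rabs_Rabsolu. apply im_le_Cmod.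
Qed.

Lemma l1_re (u : nat -> C) : l1 u -> ex_series (fun k => Re (u k)).
Proof. intro H. now apply ex_series_Rabs, l1_re_abs. Qed.

Lemma l1_im (u : nat -> C) : l1 u -> ex_series (fun k => Im (u k)).
Proof. intro H. now apply ex_series_Rabs, l1_im_abs. Qed.

Lemma C_ext (z w : C) : Re z = Re w -> Im z = Im w -> z = w.
Proof. destruct z, w; simpl; intros; subst; reflexivity. Qed.

Lemma CSeries_ext (u v : nat -> C) : (forall n, u n = v n) -> CSeries u = CSeries v.
Proof. intro H. unfold CSeries. f_equal; apply Series_ext; intro; now rewrite H. Qed.

Lemma CSeries_0 (u : nat -> C) : (forall n, u n = 0) -> CSeries u = 0.
Proof.
  intro H. apply C_ext; simpl; (rewrite (Series_ext _ (fun _ => 0 * 0));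
    [rewrite Series_scal_l; ring | intro; rewrite H; simpl; ring]).
Qed.

Lemma l1_ext (u v : nat -> C) : (forall n, u n = v n) -> l1 u -> l1 v.
Proof. intros H. apply ex_series_ext; intro; now rewrite H. Qed.

Lemma l1_plus (u v : nat -> C) : l1 u -> l1 v ->
  l1 (fun k => Cplus (u k) (v k)) /\ l1norm (fun k => Cplus (u k) (v k)) <= l1norm u + l1norm v.
Proof.
  intros Hu Hv. unfold l1norm. rewrite <- Series_plus; auto.
  apply l1_le; [intro; apply Cmod_triangle|].
  apply (ex_series_plus (V := R_NormedModule) _ _ Hu Hv).
Qed.

Lemma l1_scal (c : C) (u : nat -> C) : l1 u ->
  l1 (fun k => Cmult c (u k)) /\ l1norm (fun k => Cmult c (u k)) = Cmod c * l1norm u.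
Proof.
  intro Hu. unfold l1norm. rewrite <- Series_scal_l. split.
  - apply ex_series_ext with (fun k => Cmod c * Cmod (u k)).
    + intro; now rewrite Cmod_mult.
    + apply (ex_series_scal_l (V := R_NormedModule) (Cmod c) _ Hu).
  - apply Series_ext; intro; apply Cmod_mult.
Qed.

Lemma CSeries_plus (u v : nat -> C) : l1 u -> l1 v ->
  CSeries (fun k => Cplus (u k) (v k)) = Cplus (CSeries u) (CSeries v).
Proof.
  intros Hu Hv. apply C_ext; simpl; rewrite <- Series_plus;
    auto using l1_re, l1_im; apply Series_ext; intro; auto using re_plus, im_plus.
Qed.

Lemma CSeries_scal (c : C) (u : nat -> C) : l1 u ->
  CSeries (fun k => Cmult c (u k)) = Cmult c (CSeries u).
Proof.
  intros Hu. assert (Hr := l1_re u Hu). assert (Hi := l1_im u Hu).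
  destruct c as [x y]. apply C_ext; simpl.
  - rewrite <- !Series_scal_l, <- Series_minus.
    + apply Series_ext; intro; reflexivity.
    + apply (ex_series_scal_l (V := R_NormedModule) x _ Hr).
    + apply (ex_series_scal_l (V := R_NormedModule) y _ Hi).
  - rewrite <- !Series_scal_l, <- Series_plus.
    + apply Series_ext; intro; reflexivity.
    + apply (ex_series_scal_l (V := R_NormedModule) x _ Hi).
    + apply (ex_series_scal_l (V := R_NormedModule) y _ Hr).
Qed.

(* Multiply by the conjugate of the sum to reduce to the series of real parts. *)
Lemma Cmod_CSeries (u : nat -> C) : l1 u -> Cmod (CSeries u) <= l1norm u.
Proof.
  intro Hu. set (z := CSeries u).
  destruct (Req_dec (Cmod z) 0) as [E|E].
  { rewrite E. now apply l1norm_nonneg. }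
  assert (Hz := Cmod_ge_0 z).
  assert (H : Cmod z * Cmod z <= Cmod z * l1norm u); [|nra].
  destruct (l1_scal (Cconj z) u Hu) as [H1 H2].
  rewrite Cmod_conj in H2. rewrite <- H2.
  replace (Cmod z * Cmod z) with (Re (CSeries (fun k => Cmult (Cconj z) (u k)))).
  - apply Rle_trans with (Series (fun k => Rabs (Re (Cmult (Cconj z) (u k))))).
    + apply Rle_trans with (1 := Rle_abs _). apply Series_Rabs. now apply l1_re_abs.
    + apply Series_le; auto. intro n; split; [apply Rabs_pos | apply re_le_Cmod].
  - rewrite CSeries_scal; auto. fold z. rewrite re_mult, re_conj, im_conj.
    generalize (Cmod2_alt z). simpl. nra.
Qed.

Lemma Cfubini (u : nat -> nat -> C) :
  (forall n, l1 (u n)) -> ex_series (fun n => l1norm (u n)) ->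
  (forall m, l1 (fun n => u n m)) /\
  l1 (fun m => CSeries (fun n => u n m)) /\
  l1norm (fun m => CSeries (fun n => u n m)) <= Series (fun n => l1norm (u n)) /\
  CSeries (fun m => CSeries (fun n => u n m)) = CSeries (fun n => CSeries (u n)).
Proof.
  intros H1 H2.
  destruct (fubini_nonneg (fun n m => Cmod (u n m)) (fun n m => Cmod_ge_0 _) H1 H2)
    as (A & B & D).
  split; [exact A|].
  destruct (l1_le (fun m => CSeries (fun n => u n m)) _ (fun m => Cmod_CSeries _ (A m)) B)
    as [E F].
  repeat split; auto.
  - eapply Rle_trans; [exact F | exact D].
  - apply C_ext; simpl.
    + apply (fubini (fun n m => Re (u n m))).
      * intro n; now apply l1_re_abs.
      * apply ex_series_le_R with (2 := H2). intro n.
        rewrite Rabs_pos_eq; [|apply Series_nonneg; [intro; apply Rabs_pos|now apply l1_re_abs]].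
        apply Series_le; [|apply H1]. intro; split; [apply Rabs_pos|apply re_le_Cmod].
    + apply (fubini (fun n m => Im (u n m))).
      * intro n; now apply l1_im_abs.
      * apply ex_series_le_R with (2 := H2). intro n.
        rewrite Rabs_pos_eq; [|apply Series_nonneg; [intro; apply Rabs_pos|now apply l1_im_abs]].
        apply Series_le; [|apply H1]. intro; split; [apply Rabs_pos|apply im_le_Cmod].
Qed.

(** Coefficient sequence of [(n+1)^-s], since index [k] stands for the integer [k+1]. *)
Definition dirac (n k : nat) : C := if Nat.eqb k n then 1 else 0.

Lemma is_series_single (n : nat) (x : R) :
  is_series (fun k => if Nat.eqb k n then x else 0) x.
Proof.
  apply is_series_lim_seq.
  apply is_lim_seq_ext_loc with (fun _ => x); [|apply is_lim_seq_const].
  exists n. intros N HN. symmetry.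
  assert (H0 : forall M, (M < n)%nat -> sum_f_R0 (fun k => if Nat.eqb k n then x else 0) M = 0).
  { induction M; intro HM.
    - simpl. destruct n; [lia|reflexivity].
    - rewrite tech5, IHM by lia. destruct (Nat.eqb_spec (S M) n); [lia|ring]. }
  induction N.
  - assert (n = 0)%nat by lia. now subst.
  - rewrite tech5. destruct (Nat.eqb_spec (S N) n) as [<-|E].
    + rewrite H0 by lia. ring.
    + rewrite IHN by lia. ring.
Qed.

Lemma single_C (n : nat) (f : nat -> C) :
  l1 (fun k => Cmult (dirac n k) (f k)) /\
  CSeries (fun k => Cmult (dirac n k) (f k)) = f n.
Proof.
  assert (E : forall k, Cmult (dirac n k) (f k) = if Nat.eqb k n then f n else 0).
  { intro k. unfold dirac. destruct (Nat.eqb_spec k n) as [->|];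
      [apply Cmult_1_l | apply Cmult_0_l]. }
  split.
  - apply l1_ext with (fun k => if Nat.eqb k n then f n else 0); [intro; now rewrite E|].
    exists (Cmod (f n)). apply is_series_ext with (2 := is_series_single n (Cmod (f n))).
    intro k. destruct (Nat.eqb k n); auto. now rewrite Cmod_0.
  - rewrite (CSeries_ext _ _ E). apply C_ext; simpl; apply is_series_unique.
    + apply is_series_ext with (2 := is_series_single n (Re (f n))).
      intro k; now destruct (Nat.eqb k n).
    + apply is_series_ext with (2 := is_series_single n (Im (f n))).
      intro k; now destruct (Nat.eqb k n).
Qed.

Lemma l1_dirac (n : nat) : l1 (dirac n) /\ l1norm (dirac n) = 1.
Proof.
  assert (E : forall k, Cmod (dirac n k) = if Nat.eqb k n then 1 else 0).
  { intro k; unfold dirac. destruct (Nat.eqb k n); [apply Cmod_1 | apply Cmod_0]. }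
  assert (H : is_series (fun k => Cmod (dirac n k)) 1).
  { apply is_series_ext with (2 := is_series_single n 1). intro; now rewrite E. }
  split; [exists 1; exact H | now apply is_series_unique].
Qed.

(** * Coefficients of functions in A^+ *)

Lemma cexp_plus (z w : C) : cexp (Cplus z w) = Cmult (cexp z) (cexp w).
Proof.
  unfold cexp, Cmult; simpl. rewrite exp_plus, cos_plus, sin_plus.
  f_equal; unfold Re, Im; ring.
Qed.

Lemma cexp_0 : cexp 0 = 1.
Proof. unfold cexp; simpl. rewrite exp_0, cos_0, sin_0. unfold RtoC; f_equal; ring. Qed.

Lemma Cmod_cexp (z : C) : Cmod (cexp z) = exp (Re z).
Proof.
  unfold Cmod, cexp. simpl fst; simpl snd.
  replace ((exp (Re z) * cos (Im z)) ^ 2 + (exp (Re z) * sin (Im z)) ^ 2)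
    with (Rsqr (exp (Re z)) * (Rsqr (sin (Im z)) + Rsqr (cos (Im z)))) by (unfold Rsqr; ring).
  rewrite sin2_cos2, Rmult_1_r. apply sqrt_Rsqr. left; apply exp_pos.
Qed.

Lemma ln_INR_S_nonneg (k : nat) : 0 <= ln (INR (S k)).
Proof.
  rewrite <- ln_1. apply ln_le; [lra|]. rewrite S_INR. generalize (pos_INR k); lra.
Qed.

Lemma ln_INR_S_incr (j k : nat) : (j < k)%nat -> ln (INR (S j)) < ln (INR (S k)).
Proof. intro H. apply ln_increasing; [apply lt_0_INR; lia | apply lt_INR; lia]. Qed.

Lemma Cmod_npow (n : nat) (w : C) : Cmod (npow n w) = exp (- (Re w * ln (INR n))).
Proof. unfold npow. rewrite Cmod_cexp, re_opp, re_scal_r. reflexivity. Qed.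

Lemma Cmod_npow_le_1 (k : nat) (w : C) : 0 <= Re w -> Cmod (npow (S k) w) <= 1.
Proof.
  intro H. rewrite Cmod_npow, <- exp_0.
  assert (0 <= Re w * ln (INR (S k))) by (apply Rmult_le_pos; auto using ln_INR_S_nonneg).
  destruct (Req_dec (Re w * ln (INR (S k))) 0) as [->|]; [right; f_equal; ring|].
  left; apply exp_increasing; lra.
Qed.

Lemma npow_1 (w : C) : npow 1 w = 1.
Proof.
  unfold npow. simpl INR. rewrite ln_1, Cmult_0_r, <- cexp_0. f_equal.
  apply C_ext; simpl; ring.
Qed.

Lemma npow_mult (n m : nat) (w : C) : (0 < n)%nat -> (0 < m)%nat ->
  npow (n * m) w = Cmult (npow n w) (npow m w).
Proof.
  intros Hn Hm. unfold npow. rewrite <- cexp_plus. f_equal.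
  rewrite mult_INR, ln_mult by (now apply lt_0_INR). rewrite RtoC_plus. ring.
Qed.

Lemma npow_plus (n : nat) (z w : C) : npow n (Cplus z w) = Cmult (npow n z) (npow n w).
Proof. unfold npow. rewrite <- cexp_plus. f_equal. ring. Qed.

Lemma npow_pow (n k : nat) (w : C) : (0 < n)%nat ->
  npow (n ^ k) w = Cpow (npow n w) k.
Proof.
  intro Hn. induction k as [|k IH]; simpl.
  - apply npow_1.
  - rewrite npow_mult, IH; auto. apply Nat.neq_0_lt_0, Nat.pow_nonzero. lia.
Qed.

Lemma Cmod_dterm_le (a : nat -> C) (s : C) (k : nat) :
  0 <= Re s -> Cmod (dterm a s k) <= Cmod (a k).
Proof.
  intro H. unfold dterm. rewrite Cmod_mult.
  generalize (Cmod_npow_le_1 k s H) (Cmod_ge_0 (a k)); nra.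
Qed.

Lemma l1_dterm (a : nat -> C) (s : C) : l1 a -> 0 <= Re s ->
  l1 (dterm a s) /\ l1norm (dterm a s) <= l1norm a.
Proof. intros Ha Hs. apply l1_le; auto. intro; now apply Cmod_dterm_le. Qed.

Lemma Cmod_Dir (a : nat -> C) (s : C) : l1 a -> 0 <= Re s -> Cmod (Dir a s) <= l1norm a.
Proof.
  intros Ha Hs. destruct (l1_dterm a s Ha Hs).
  eapply Rle_trans; [now apply Cmod_CSeries | auto].
Qed.

Lemma Cmod_Ap_rep (a : nat -> C) (f : C -> C) (s : C) :
  Ap_rep a f -> 0 < Re s -> Cmod (f s) <= l1norm a.
Proof. intros [Ha Hf] Hs. rewrite Hf; auto. apply Cmod_Dir; auto; lra. Qed.

Lemma Ap_rep_Dir (a : nat -> C) : l1 a -> Ap_rep a (Dir a).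
Proof. intro; split; auto. Qed.

Lemma Ap_rep_ext (a : nat -> C) (f g : C -> C) :
  (forall s, 0 < Re s -> f s = g s) -> Ap_rep a f -> Ap_rep a g.
Proof. intros H [Ha Hf]; split; auto. intros s Hs; rewrite <- H; auto. Qed.

Lemma Ap_rep_plus (a b : nat -> C) (f g : C -> C) :
  Ap_rep a f -> Ap_rep b g ->
  Ap_rep (fun k => Cplus (a k) (b k)) (fun s => Cplus (f s) (g s)).
Proof.
  intros [Ha Hf] [Hb Hg]; split; [now apply l1_plus|].
  intros s Hs. rewrite Hf, Hg; auto. unfold Dir. rewrite <- CSeries_plus.
  - apply CSeries_ext; intro; unfold dterm; ring.
  - apply l1_dterm; auto; lra.
  - apply l1_dterm; auto; lra.
Qed.

Lemma Ap_rep_scal (c : C) (a : nat -> C) (f : C -> C) :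
  Ap_rep a f -> Ap_rep (fun k => Cmult c (a k)) (fun s => Cmult c (f s)).
Proof.
  intros [Ha Hf]; split; [now apply l1_scal|].
  intros s Hs. rewrite Hf; auto. unfold Dir. rewrite <- CSeries_scal.
  - apply CSeries_ext; intro; unfold dterm; ring.
  - apply l1_dterm; auto; lra.
Qed.

Lemma Ap_rep_minus (a b : nat -> C) (f g : C -> C) :
  Ap_rep a f -> Ap_rep b g ->
  Ap_rep (fun k => Cminus (a k) (b k)) (fun s => Cminus (f s) (g s)).
Proof.
  intros Ha Hb.
  assert (H := Ap_rep_plus _ _ _ _ Ha (Ap_rep_scal (-1) _ _ Hb)).
  replace (fun k => Cminus (a k) (b k)) with (fun k => Cplus (a k) (Cmult (-1) (b k))).
  - apply Ap_rep_ext with (2 := H). intros; ring.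
  - apply functional_extensionality; intro; ring.
Qed.

Lemma Dir_dirac (n : nat) (w : C) : Dir (dirac n) w = npow (S n) w.
Proof. apply single_C. Qed.

Lemma Ap_rep_npow (n : nat) : Ap_rep (dirac n) (npow (S n)).
Proof. split; [apply l1_dirac | intros; now rewrite Dir_dirac]. Qed.

(** * Infinite superpositions in A^+, partial sums and tails *)

Definition superp (al : nat -> C) (b : nat -> nat -> C) (m : nat) : C :=
  CSeries (fun n => Cmult (al n) (b n m)).

(** Fubini is used twice: on the coefficients for the norm, and after multiplication by [(m+1)^-s]
    for the values. The last clause includes the line [Re s = 0], because it is evaluated at [phi s]
    when only [0 <= Re (phi s)] is known. *)
Lemma l1_superp (al : nat -> C) (b : nat -> nat -> C) :
  (forall n, l1 (b n)) -> ex_series (fun n => Cmod (al n) * l1norm (b n)) ->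
  l1 (superp al b) /\
  l1norm (superp al b) <= Series (fun n => Cmod (al n) * l1norm (b n)) /\
  forall s, 0 <= Re s -> Dir (superp al b) s = CSeries (fun n => Cmult (al n) (Dir (b n) s)).
Proof.
  intros Hb Hs.
  set (u := fun n m => Cmult (al n) (b n m)).
  assert (H1 : forall n, l1 (u n)) by (intro n; apply l1_scal, Hb).
  assert (E : forall n, l1norm (u n) = Cmod (al n) * l1norm (b n))
    by (intro n; apply l1_scal, Hb).
  assert (H2 : ex_series (fun n => l1norm (u n))).
  { apply ex_series_ext with (2 := Hs). intro; now rewrite E. }
  destruct (Cfubini u H1 H2) as (_ & A & B & _).
  rewrite (Series_ext _ _ E) in B.
  split; [|split]; auto.
  intros s Hs0.
  set (v := fun n m => Cmult (u n m) (npow (S m) s)).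
  assert (V1 : forall n, l1 (v n) /\ l1norm (v n) <= l1norm (u n))
    by (intro n; now apply (l1_dterm (u n) s)).
  assert (V2 : ex_series (fun n => l1norm (v n))).
  { apply ex_series_le_R with (2 := H2). intro n. rewrite Rabs_pos_eq.
    - apply V1.
    - apply l1norm_nonneg, V1. }
  destruct (Cfubini v (fun n => proj1 (V1 n)) V2) as (_ & _ & _ & F).
  transitivity (CSeries (fun n => CSeries (v n))).
  - rewrite <- F. apply CSeries_ext; intro m. unfold dterm, superp.
    rewrite Cmult_comm, <- CSeries_scal.
    + apply CSeries_ext; intro n. unfold v, u; ring.
    + apply (Cfubini u H1 H2).
  - apply CSeries_ext; intro n. unfold Dir.
    rewrite <- CSeries_scal by now apply l1_dterm.
    apply CSeries_ext; intro m. unfold v, u, dterm; ring.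
Qed.

Lemma Ap_rep_superp (al : nat -> C) (b : nat -> nat -> C) (g : nat -> C -> C) :
  (forall n, Ap_rep (b n) (g n)) ->
  ex_series (fun n => Cmod (al n) * l1norm (b n)) ->
  Ap_rep (superp al b) (fun s => CSeries (fun n => Cmult (al n) (g n s))) /\
  l1norm (superp al b) <= Series (fun n => Cmod (al n) * l1norm (b n)).
Proof.
  intros Hb Hs.
  destruct (l1_superp al b (fun n => proj1 (Hb n)) Hs) as (A & B & D).
  split; [split|]; auto.
  intros s Hs0. rewrite D by lra. apply CSeries_ext; intro n. f_equal. now apply Hb.
Qed.

Fixpoint csum (f : nat -> C) (N : nat) : C :=
  match N with O => 0 | S N' => Cplus (csum f N') (f N') end.

Lemma CSeries_csum_tail (u : nat -> C) (N : nat) : l1 u ->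
  l1 (fun k => u (N + k)%nat) /\
  CSeries u = Cplus (csum u N) (CSeries (fun k => u (N + k)%nat)).
Proof.
  intro Hu. induction N as [|N [IH1 IH2]].
  - split; [exact Hu|]. simpl. rewrite Cplus_0_l. reflexivity.
  - assert (T : l1 (fun k => u (S N + k)%nat)).
    { apply ex_series_incr_1 in IH1. apply ex_series_ext with (2 := IH1).
      intro k. do 2 f_equal. lia. }
    split; auto. rewrite IH2. simpl csum. rewrite <- Cplus_assoc. f_equal.
    assert (Hr := l1_re _ IH1). assert (Hi := l1_im _ IH1).
    apply C_ext.
    + rewrite re_plus. simpl. rewrite Series_incr_1; auto.
      f_equal; [do 2 f_equal; lia | apply Series_ext; intro; do 2 f_equal; lia].
    + rewrite im_plus. simpl. rewrite Series_incr_1; auto.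
      f_equal; [do 2 f_equal; lia | apply Series_ext; intro; do 2 f_equal; lia].
Qed.

Lemma l1_tail_small (u : nat -> C) (eps : R) : l1 u -> 0 < eps ->
  exists N0, forall N, (N0 <= N)%nat -> l1norm (fun k => u (N + k)%nat) < eps.
Proof.
  intros Hu He.
  assert (Hl := proj1 (is_series_lim_seq _ _) (Series_correct _ Hu)).
  apply is_lim_seq_spec in Hl. destruct (Hl (mkposreal eps He)) as [N0 HN]. simpl in HN.
  exists (S N0). intros N HN0. destruct N as [|N]; [lia|].
  specialize (HN N ltac:(lia)).
  rewrite (Series_incr_n (fun k => Cmod (u k)) (S N)) in HN; [|lia|exact Hu].
  simpl pred in HN. unfold l1norm. apply Rabs_def2 in HN. lra.
Qed.

Lemma csum_ext (f g : nat -> C) (N : nat) :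
  (forall k, (k < N)%nat -> f k = g k) -> csum f N = csum g N.
Proof.
  induction N; intro H; simpl; auto. rewrite IHN, H; auto.
Qed.

Lemma csum_scal (c : C) (f : nat -> C) (N : nat) :
  csum (fun k => Cmult c (f k)) N = Cmult c (csum f N).
Proof. induction N; simpl; [ring|]. rewrite IHN; ring. Qed.

Lemma csum_plus (f g : nat -> C) (N : nat) :
  csum (fun k => Cplus (f k) (g k)) N = Cplus (csum f N) (csum g N).
Proof. induction N; simpl; [ring|]. rewrite IHN; ring. Qed.

Lemma Cmod_csum (f : nat -> C) (g : nat -> R) (N : nat) :
  (forall k, (k <= N)%nat -> Cmod (f k) <= g k) -> Cmod (csum f (S N)) <= sum_f_R0 g N.
Proof.
  induction N; intro H.
  - simpl. rewrite Cplus_0_l. auto.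
  - change (csum f (S (S N))) with (Cplus (csum f (S N)) (f (S N))).
    rewrite tech5. eapply Rle_trans; [apply Cmod_triangle|].
    apply Rplus_le_compat; auto.
Qed.

(** * Bohr's inequality and uniqueness of coefficients *)

Definition cis (x : R) : C := (cos x, sin x).

Lemma cis_plus (x y : R) : cis (x + y) = Cmult (cis x) (cis y).
Proof. unfold cis, Cmult; simpl. rewrite cos_plus, sin_plus. f_equal; ring. Qed.

Lemma Cmod_cis (x : R) : Cmod (cis x) = 1.
Proof.
  unfold Cmod, cis; simpl fst; simpl snd.
  replace (cos x ^ 2 + sin x ^ 2) with (Rsqr (sin x) + Rsqr (cos x)) by (unfold Rsqr; ring).
  rewrite sin2_cos2. apply sqrt_1.
Qed.

Lemma cis_PI (x : R) : x <> 0 -> cis (x * (PI / x)) = (-1)%R.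
Proof.
  intro H. replace (x * (PI / x)) with PI by (field; auto).
  unfold cis. rewrite cos_PI, sin_PI. reflexivity.
Qed.

(* Averaging over the translation by [PI / mu k] removes the frequency [mu k] and neither
   increases the supremum nor touches the constant term. *)
Lemma trig_poly_constant_term (S : R) (al : C) (mu : nat -> R) (N : nat) :
  forall be : nat -> C,
  (forall k, (k < N)%nat -> be k = 0 \/ mu k <> 0) ->
  (forall t, Cmod (Cplus al (csum (fun k => Cmult (be k) (cis (mu k * t))) N)) <= S) ->
  Cmod al <= S.
Proof.
  induction N as [|N IH]; intros be Hbe HS.
  - specialize (HS 0). simpl in HS. now rewrite Cplus_0_r in HS.
  - destruct (Hbe N ltac:(lia)) as [E|E].
    + apply (IH be); [intros; apply Hbe; lia|].
      intro t. specialize (HS t). simpl in HS. rewrite E, Cmult_0_l, Cplus_0_r in HS. exact HS.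
    + set (tau := PI / mu N).
      (* The mean of the values at [t] and [t + tau] multiplies the [k]-th coefficient by
         [(1 + cis (mu k * tau)) / 2], which is zero at [k = N]. *)
      apply (IH (fun k => Cmult (be k) (Cmult (/ 2)%R (Cplus 1 (cis (mu k * tau)))))).
      * intros k Hk. destruct (Hbe k ltac:(lia)) as [->|]; auto. left; apply Cmult_0_l.
      * intro t. assert (H1 := HS t). assert (H2 := HS (t + tau)).
        set (A := Cplus al (csum (fun k => Cmult (be k) (cis (mu k * t))) (Datatypes.S N))) in *.
        set (B := Cplus al (csum (fun k => Cmult (be k) (cis (mu k * (t + tau)))) (Datatypes.S N))) in *.
        replace (Cplus al _) with (Cmult (/ 2)%R (Cplus A B)).
        -- rewrite Cmod_mult, Cmod_R, Rabs_pos_eq by lra.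
           generalize (Cmod_triangle A B). lra.
        -- unfold A, B. simpl csum.
           replace (cis (mu N * (t + tau))) with (Copp (cis (mu N * t))).
           2:{ rewrite Rmult_plus_distr_l, cis_plus. unfold tau. rewrite cis_PI; auto.
               apply C_ext; simpl; ring. }
           rewrite (csum_ext (fun k => Cmult (Cmult (be k) _) _)
             (fun k => Cmult (/ 2)%R (Cplus (Cmult (be k) (cis (mu k * t)))
                                  (Cmult (be k) (cis (mu k * (t + tau))))))).
           ++ rewrite csum_scal, csum_plus.
              assert (D : forall z : C, z = Cmult (/ 2)%R (Cplus z z)).
              { intros [p q]; apply C_ext; simpl; field. }
              rewrite (D al) at 3. ring.
           ++ intros k _. rewrite Rmult_plus_distr_l, cis_plus. ring.
Qed.

Lemma npow_cis (k : nat) (x t : R) :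
  npow (S k) (x, t) = Cmult (exp (- (x * ln (INR (S k)))))%R (cis (- (ln (INR (S k)) * t))).
Proof.
  apply C_ext.
  - rewrite re_scal_l. simpl. f_equal; f_equal; ring.
  - rewrite im_scal_l. simpl. f_equal; f_equal; ring.
Qed.

(* Bohr's inequality. *)
Lemma coef_bound_line (a : nat -> C) (x S : R) (m : nat) : l1 a -> 0 <= x ->
  (forall t, Cmod (Dir a (x, t)) <= S) ->
  Cmod (a m) * exp (- (x * ln (INR (Datatypes.S m)))) <= S.
Proof.
  intros Ha Hx HS. apply le_epsilon. intros eps He.
  destruct (l1_tail_small a eps Ha He) as [N0 HN0].
  set (N := (N0 + m + 1)%nat).
  set (lam := fun k => ln (INR (Datatypes.S k))).
  set (al := fun k => Cmult (a k) (exp (- (x * lam k)))%R).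
  (* The term of index [m] becomes the constant [al m]; its place in the sum is kept with
     coefficient zero, the only index where the frequency [lam m - lam k] vanishes. *)
  set (be := fun k => if Nat.eqb k m then RtoC 0 else al k).
  replace (Cmod (a m) * _) with (Cmod (al m)).
  2:{ unfold al. rewrite Cmod_mult, Cmod_R, Rabs_pos_eq; auto. left; apply exp_pos. }
  apply (trig_poly_constant_term _ _ (fun k => lam m - lam k) N be).
  - intros k Hk. unfold be. destruct (Nat.eqb_spec k m); auto. right.
    destruct (Nat.lt_gt_cases k m) as [L _]. destruct (L n) as [H|H];
      generalize (ln_INR_S_incr _ _ H); unfold lam; lra.
  - intro t.
    assert (Hs : 0 <= Re (x, t)) by exact Hx.
    destruct (l1_dterm a (x, t) Ha Hs) as [Hd _].
    destruct (CSeries_csum_tail _ N Hd) as [Ht E].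
    assert (T : Cmod (CSeries (fun k => dterm a (x, t) (N + k)%nat)) <= eps).
    { apply Rle_trans with (1 := Cmod_CSeries _ Ht).
      apply Rle_trans with (l1norm (fun k => a (N + k)%nat)).
      - apply l1_le; [intro; now apply Cmod_dterm_le | now apply (CSeries_csum_tail a N)].
      - left; apply HN0. unfold N; lia. }
    (* Factoring out the unimodular [cis (- (lam m * t))] makes the [m]-th term constant. The case
       distinction serves the induction on [M]: as long as the partial sum does not contain index
       [m], that term is added by hand. *)
    assert (F : forall M, (if Nat.ltb m M then csum (dterm a (x, t)) M else
         Cplus (csum (dterm a (x, t)) M) (dterm a (x, t) m)) =
       Cmult (cis (- (lam m * t))) (Cplus (al m)
         (csum (fun k => Cmult (be k) (cis ((lam m - lam k) * t))) M))).
    { assert (Q : forall k, dterm a (x, t) k = Cmult (cis (- (lam m * t)))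
                  (Cmult (al k) (cis ((lam m - lam k) * t)))).
      { intro k. unfold dterm, al. rewrite npow_cis. fold (lam k).
        replace (- (lam k * t)) with (- (lam m * t) + (lam m - lam k) * t) by ring.
        rewrite cis_plus. ring. }
      assert (Qm : dterm a (x, t) m = Cmult (cis (- (lam m * t))) (al m)).
      { rewrite Q. replace ((lam m - lam m) * t) with 0 by ring.
        unfold cis at 2. rewrite cos_0, sin_0. change (1, 0) with (RtoC 1). ring. }
      induction M as [|M IH].
      - simpl. rewrite Qm. ring.
      - simpl csum. rewrite Cplus_assoc, Cmult_plus_distr_l, <- IH. clear IH.
        unfold be. destruct (Nat.eqb_spec M m) as [->|HM].
        + rewrite Nat.ltb_irrefl. destruct (Nat.ltb_spec m (Datatypes.S m)); [|lia]. ring.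
        + rewrite (Q M).
          destruct (Nat.ltb_spec m (Datatypes.S M)), (Nat.ltb_spec m M); try lia; ring. }
    specialize (F N). destruct (Nat.ltb_spec m N) as [_|]; [|unfold N in *; lia].
    apply Rle_trans with (Cmod (csum (dterm a (x, t)) N)).
    + rewrite F, Cmod_mult, Cmod_cis. lra.
    + replace (csum (dterm a (x, t)) N) with
        (Cplus (Dir a (x, t)) (Copp (CSeries (fun k => dterm a (x, t) (N + k)%nat)))).
      * eapply Rle_trans; [apply Cmod_triangle|]. rewrite Cmod_opp.
        specialize (HS t). lra.
      * unfold Dir. rewrite E. ring.
Qed.

(** Passage to the limit along [x = 1 / (n+1)]; it carries estimates from the lines [Re s = x] to
    the boundary. *)
Lemma le_of_le_exp (X Y k : R) :
  (forall x, 0 < x -> X <= Y * exp (k * x)) -> X <= Y.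
Proof.
  intro H.
  assert (L : is_lim_seq (fun n => Y * exp (k * / INR (S n))) (Y * exp (k * 0))).
  { apply is_lim_seq_mult'; [apply is_lim_seq_const|].
    apply (is_lim_seq_continuous exp (fun n => k * / INR (S n))).
    - apply derivable_continuous_pt, derivable_pt_exp.
    - apply is_lim_seq_mult'; [apply is_lim_seq_const|].
      apply (is_lim_seq_incr_1 (fun n => / INR n)).
      replace (Finite 0) with (Rbar_inv p_infty) by reflexivity.
      apply is_lim_seq_inv; [apply is_lim_seq_INR | discriminate]. }
  rewrite Rmult_0_r, exp_0, Rmult_1_r in L.
  apply (is_lim_seq_le (fun _ => X) _ X Y) with (2 := is_lim_seq_const X) (3 := L).
  intro n. apply H. apply Rinv_0_lt_compat, lt_0_INR. lia.
Qed.

(** Both the growth factor [exp (k * x)] and the weight [(m+1)^-x] of Bohr's inequality tend to 1 as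
    [x] tends to 0. The growth is permitted with a view to the term [c0 s] of the symbol. *)
Lemma coef_bound (a : nat -> C) (f : C -> C) (S k : R) (m : nat) : Ap_rep a f ->
  (forall s, 0 < Re s -> Cmod (f s) <= S * exp (k * Re s)) -> Cmod (a m) <= S.
Proof.
  intros [Ha Hf] HS.
  apply (le_of_le_exp _ _ (k + ln (INR (Datatypes.S m)))). intros x Hx.
  assert (H : Cmod (a m) * exp (- (x * ln (INR (Datatypes.S m)))) <= S * exp (k * x)).
  { apply coef_bound_line; auto; [lra|]. intro t.
    rewrite <- Hf by exact Hx. apply (HS (x, t)). exact Hx. }
  apply (Rmult_le_compat_r (exp (x * ln (INR (Datatypes.S m))))) in H; [|left; apply exp_pos].
  rewrite !Rmult_assoc, <- !exp_plus in H.
  replace (- (x * ln (INR (Datatypes.S m))) + x * ln (INR (Datatypes.S m))) with 0 in H by ring.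
  rewrite exp_0, Rmult_1_r in H.
  eapply Rle_trans; [exact H|]. right; do 2 f_equal; ring.
Qed.

Lemma coef_bound_sup (a : nat -> C) (f : C -> C) (S : R) (m : nat) : Ap_rep a f ->
  (forall s, 0 < Re s -> Cmod (f s) <= S) -> Cmod (a m) <= S.
Proof.
  intros H HS. apply (coef_bound a f S 0 m H). intros s Hs.
  rewrite Rmult_0_l, exp_0, Rmult_1_r; auto.
Qed.

Lemma Ap_rep_unique (a b : nat -> C) (f : C -> C) :
  Ap_rep a f -> Ap_rep b f -> a = b.
Proof.
  intros Ha Hb. apply functional_extensionality; intro m.
  assert (H := coef_bound_sup _ _ 0 m (Ap_rep_minus _ _ _ _ Ha Hb)). simpl in H.
  assert (E : Cmod (Cminus (a m) (b m)) = 0).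
  { apply Rle_antisym; [apply H | apply Cmod_ge_0]. intros s Hs.
    replace (Cminus (f s) (f s)) with (RtoC 0) by ring. rewrite Cmod_0; lra. }
  apply Cmod_eq_0 in E. replace (a m) with (Cplus (Cminus (a m) (b m)) (b m)) by ring.
  rewrite E. ring.
Qed.

(** By uniqueness of the coefficients, the infimum is taken over a single number. *)
Lemma Apnorm_rep (a : nat -> C) (f : C -> C) : Ap_rep a f -> Apnorm f = l1norm a.
Proof.
  intro H. unfold Apnorm.
  rewrite (is_glb_Rbar_unique _ (Finite (l1norm a))); [reflexivity|].
  split.
  - intros r [b [Hb ->]]. rewrite (Ap_rep_unique _ _ _ Hb H). simpl; lra.
  - intros b Hb. apply Hb. exists a; auto.
Qed.

(** * Products and exponentials in A^+ *)

Lemma ex_series_ext_R (u v : nat -> R) :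
  (forall n, u n = v n) -> ex_series u -> ex_series v.
Proof. exact (@ex_series_ext R_AbsRing R_NormedModule u v). Qed.

Lemma CV_radius_infinite (a : nat -> R) :
  (forall x, ex_series (fun n => a n * x ^ n)) -> CV_radius a = p_infty.
Proof.
  intro H. assert (H0 := CV_radius_ge_0 a).
  destruct (CV_radius a) as [r| |] eqn:E; auto; [|contradiction].
  exfalso. apply (CV_disk_outside a (r + 1)).
  - rewrite E. simpl. simpl in H0. rewrite Rabs_pos_eq; lra.
  - apply ex_series_lim_0. apply H.
Qed.

Lemma is_series_exp (x : R) : is_series (fun k => / INR (fact k) * x ^ k) (exp x).
Proof.
  apply is_pseries_R, is_exp_Reals.
Qed.

Lemma l1_exp_terms (z : C) : l1 (fun k => Cmult (/ INR (fact k))%R (Cpow z k)).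
Proof.
  exists (exp (Cmod z)). apply is_series_ext with (2 := is_series_exp (Cmod z)).
  intro n. rewrite Cmod_mult, Cmod_pow, Cmod_R, Rabs_pos_eq; auto.
  left. apply Rinv_0_lt_compat, INR_fact_lt_0.
Qed.

Lemma RtoC_Cpow (x : R) (n : nat) : RtoC (x ^ n) = Cpow x n.
Proof. induction n; simpl; auto. now rewrite RtoC_mult, IHn. Qed.

(* With [f + i g = sum_k (t z)^k / k!], the product [exp(- t z) (f + i g)] has derivative zero
   in the real variable [t]. *)
Lemma cexp_series (z : C) :
  cexp z = CSeries (fun k => Cmult (/ INR (fact k))%R (Cpow z k)).
Proof.
  set (a := fun k => / INR (fact k) * Re (Cpow z k)).
  set (b := fun k => / INR (fact k) * Im (Cpow z k)).
  set (x := Re z). set (y := Im z).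
  assert (Q : forall t, l1 (fun k => Cmult (/ INR (fact k))%R (Cpow (Cmult t z) k))).
  { intro t; apply l1_exp_terms. }
  assert (Ha : CV_radius a = p_infty).
  { apply CV_radius_infinite. intro t.
    apply ex_series_ext_R with (2 := l1_re _ (Q t)). intro n. unfold a.
    rewrite Cpow_mult_l, <- RtoC_Cpow, Cmult_assoc, <- RtoC_mult, re_scal_l. ring. }
  assert (Hb : CV_radius b = p_infty).
  { apply CV_radius_infinite. intro t.
    apply ex_series_ext_R with (2 := l1_im _ (Q t)). intro n. unfold b.
    rewrite Cpow_mult_l, <- RtoC_Cpow, Cmult_assoc, <- RtoC_mult, im_scal_l. ring. }
  set (f := PSeries a). set (g := PSeries b).
  assert (Ea : forall t, ex_pseries a t).
  { intro t. apply CV_radius_inside. now rewrite Ha. }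
  assert (Eb : forall t, ex_pseries b t).
  { intro t. apply CV_radius_inside. now rewrite Hb. }
  (* Termwise differentiation lowers the factorial; with [z^(n+1) = z * z^n] this gives the linear
     system [f' = x f - y g], [g' = y f + x g]. *)
  assert (F : forall n, / INR (fact n) = INR (S n) * / INR (fact (S n))).
  { intro n. rewrite fact_simpl, mult_INR. field.
    split; [apply INR_fact_neq_0 | apply not_0_INR; lia]. }
  assert (Df : forall t, is_derive f t (x * f t - y * g t)).
  { intro t. unfold f, g. rewrite <- !PSeries_scal, <- PSeries_minus.
    - rewrite (PSeries_ext _ (PS_derive a)).
      + apply is_derive_PSeries. now rewrite Ha.
      + intro n. unfold PS_derive, PS_minus, PS_plus, PS_scal, PS_opp, a, b, x, y.
        cbv -[Rplus Rmult Ropp Rinv INR fact Re Im Cpow]. rewrite (F n).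
        change (Cpow z (S n)) with (Cmult z (Cpow z n)). rewrite re_mult. ring.
    - apply ex_pseries_scal; [apply Rmult_comm | apply Ea].
    - apply ex_pseries_scal; [apply Rmult_comm | apply Eb]. }
  assert (Dg : forall t, is_derive g t (y * f t + x * g t)).
  { intro t. unfold f, g. rewrite <- !PSeries_scal, <- PSeries_plus.
    - rewrite (PSeries_ext _ (PS_derive b)).
      + apply is_derive_PSeries. now rewrite Hb.
      + intro n. unfold PS_derive, PS_plus, PS_scal, a, b, x, y.
        cbv -[Rplus Rmult Ropp Rinv INR fact Re Im Cpow]. rewrite (F n).
        change (Cpow z (S n)) with (Cmult z (Cpow z n)). rewrite im_mult. ring.
    - apply ex_pseries_scal; [apply Rmult_comm | apply Ea].
    - apply ex_pseries_scal; [apply Rmult_comm | apply Eb]. }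
  assert (Ef : forall t, Derive (fun r : R => f r) t = x * f t - y * g t).
  { intro t. apply is_derive_unique, Df. }
  assert (Eg : forall t, Derive (fun r : R => g r) t = y * f t + x * g t).
  { intro t. apply is_derive_unique, Dg. }
  (* [u] and [v] are the real and imaginary parts of [exp (- t z) (f + i g)]; their constancy is
     compared at 0 and 1, and the rotation by [y] is then inverted. *)
  set (u := fun t => exp (- (x * t)) * (cos (y * t) * f t + sin (y * t) * g t)).
  set (v := fun t => exp (- (x * t)) * (cos (y * t) * g t - sin (y * t) * f t)).
  assert (U : u 0 = u 1).
  { apply (eq_is_derive u 0 1); [|lra]. intros t _. unfold u.
    auto_derive.
    - repeat split; try (exists (x * f t - y * g t); apply Df);
        try (exists (y * f t + x * g t); apply Dg).
    - rewrite Ef, Eg. change (@zero R_NormedModule) with 0. ring. }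
  assert (V : v 0 = v 1).
  { apply (eq_is_derive v 0 1); [|lra]. intros t _. unfold v.
    auto_derive.
    - repeat split; try (exists (x * f t - y * g t); apply Df);
        try (exists (y * f t + x * g t); apply Dg).
    - rewrite Ef, Eg. change (@zero R_NormedModule) with 0. ring. }
  unfold u, v in U, V. rewrite !Rmult_0_r, !Rmult_1_r, Ropp_0, exp_0, cos_0, sin_0 in U, V.
  assert (F0 : f 0 = 1) by (unfold f; rewrite PSeries_0; unfold a; simpl; field).
  assert (G0 : g 0 = 0) by (unfold g; rewrite PSeries_0; unfold b; simpl; ring).
  rewrite F0, G0 in U, V.
  assert (F1 : f 1 = Re (CSeries (fun k => Cmult (/ INR (fact k))%R (Cpow z k)))).
  { unfold f. rewrite PSeries_1. simpl. apply Series_ext; intro.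
    unfold a. now rewrite <- re_scal_l. }
  assert (G1 : g 1 = Im (CSeries (fun k => Cmult (/ INR (fact k))%R (Cpow z k)))).
  { unfold g. rewrite PSeries_1. simpl. apply Series_ext; intro.
    unfold b. now rewrite <- im_scal_l. }
  assert (P : exp x * exp (- x) = 1) by (rewrite <- exp_plus, Rplus_opp_r; apply exp_0).
  generalize (sin2_cos2 y); unfold Rsqr; intro SC.
  assert (U' : cos y * f 1 + sin y * g 1 = exp x).
  { replace (exp x) with (exp x * (1 * (1 * 1 + 0 * 0))) by ring. rewrite U.
    rewrite <- Rmult_assoc, P. ring. }
  assert (V' : cos y * g 1 - sin y * f 1 = 0).
  { replace 0 with (exp x * (1 * (1 * 0 - 0 * 1))) at 1 by ring. rewrite V.
    rewrite <- Rmult_assoc, P. ring. }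
  apply C_ext; [rewrite <- F1; change (Re (cexp z)) with (exp x * cos y)
    | rewrite <- G1; change (Im (cexp z)) with (exp x * sin y)]; rewrite <- U'.
  - transitivity (f 1 * (sin y * sin y + cos y * cos y) + sin y * (cos y * g 1 - sin y * f 1));
      [ring | rewrite SC, V'; ring].
  - transitivity (g 1 * (sin y * sin y + cos y * cos y) - cos y * (cos y * g 1 - sin y * f 1));
      [ring | rewrite SC, V'; ring].
Qed.

Lemma ex_series_scal_R (c : R) (u : nat -> R) : ex_series u -> ex_series (fun n => c * u n).
Proof. exact (@ex_series_scal_l R_AbsRing R_NormedModule c u). Qed.

(** Coefficients of [(n+1)^-s g(s)]: the coefficient of the integer [j+1] moves to the integer
    [(n+1)(j+1)], and [pred] restores the index offset. *)
Definition shift (n : nat) (b : nat -> C) : nat -> C :=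
  superp b (fun j => dirac (pred (S n * S j))).

Lemma Ap_rep_shift (n : nat) (b : nat -> C) (g : C -> C) : Ap_rep b g ->
  Ap_rep (shift n b) (fun s => Cmult (npow (S n) s) (g s)) /\
  l1norm (shift n b) <= l1norm b.
Proof.
  intros [Hb Hg].
  assert (E : forall j, Cmod (b j) * l1norm (dirac (pred (S n * S j))) = Cmod (b j)).
  { intro j. rewrite (proj2 (l1_dirac _)). ring. }
  destruct (Ap_rep_superp b (fun j => dirac (pred (S n * S j)))
    (fun j => npow (S n * S j))) as [A B].
  - intro j. apply (Ap_rep_npow (pred (S n * S j))).
  - apply ex_series_ext_R with (2 := Hb). intro; now rewrite E.
  - rewrite (Series_ext _ _ E) in B. split; auto.
    apply Ap_rep_ext with (2 := A). intros s Hs. rewrite Hg; auto.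
    unfold Dir. rewrite <- CSeries_scal by (apply l1_dterm; auto; lra).
    apply CSeries_ext; intro j. rewrite npow_mult by lia. unfold dterm. ring.
Qed.

(** Dirichlet convolution. Written as a superposition of dilated copies of [b], it inherits
    summability and the norm bound, and no sum over divisors is needed. *)
Definition conv (a b : nat -> C) : nat -> C := superp a (fun n => shift n b).

Lemma Ap_rep_conv (a b : nat -> C) (f g : C -> C) : Ap_rep a f -> Ap_rep b g ->
  Ap_rep (conv a b) (fun s => Cmult (f s) (g s)) /\
  l1norm (conv a b) <= l1norm a * l1norm b.
Proof.
  intros [Ha Hf] Hb.
  assert (E : forall n, 0 <= Cmod (a n) * l1norm (shift n b) <= l1norm b * Cmod (a n)).
  { intro n. destruct (Ap_rep_shift n b g Hb) as [[A _] B].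
    generalize (Cmod_ge_0 (a n)) (l1norm_nonneg _ A). split; nra. }
  assert (X : ex_series (fun n => l1norm b * Cmod (a n))) by now apply ex_series_scal_R.
  destruct (Ap_rep_superp a (fun n => shift n b) (fun n s => Cmult (npow (S n) s) (g s)))
    as [A B].
  - intro n. now apply Ap_rep_shift.
  - apply ex_series_le_R with (2 := X). intro n. rewrite Rabs_pos_eq; apply E.
  - split.
    + apply Ap_rep_ext with (2 := A). intros s Hs. rewrite Hf, Cmult_comm; auto.
      unfold Dir. rewrite <- CSeries_scal by (apply l1_dterm; auto; lra).
      apply CSeries_ext; intro n. unfold dterm. ring.
    + eapply Rle_trans; [exact B|]. rewrite Rmult_comm. unfold l1norm at 3.
      rewrite <- Series_scal_l. now apply Series_le.
Qed.

(** Every term of the double sum vanishes. It serves to locate the integers that occur in powers of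
    a Dirichlet polynomial. *)
Lemma conv_eq_0 (a b : nat -> C) (m : nat) :
  (forall n j, a n <> 0 -> b j <> 0 -> S m = (S n * S j)%nat -> False) -> conv a b m = 0.
Proof.
  intro H. apply CSeries_0; intro n.
  destruct (classic (a n = 0)) as [->|Hn]; [apply Cmult_0_l|].
  replace (shift n b m) with (RtoC 0); [apply Cmult_0_r|]. symmetry.
  apply CSeries_0; intro j.
  destruct (classic (b j = 0)) as [->|Hj]; [apply Cmult_0_l|].
  unfold dirac. destruct (Nat.eqb_spec m (pred (S n * S j))) as [E|]; [|apply Cmult_0_r].
  exfalso. apply (H n j Hn Hj). rewrite E. simpl. reflexivity.
Qed.

Fixpoint conv_pow (a : nat -> C) (k : nat) : nat -> C :=
  match k with O => dirac 0 | S k' => conv a (conv_pow a k') end.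

Lemma Ap_rep_conv_pow (a : nat -> C) (f : C -> C) (k : nat) : Ap_rep a f ->
  Ap_rep (conv_pow a k) (fun s => Cpow (f s) k) /\ l1norm (conv_pow a k) <= l1norm a ^ k.
Proof.
  intro H. induction k as [|k [IH1 IH2]]; simpl.
  - split.
    + apply Ap_rep_ext with (2 := Ap_rep_npow 0). intros; apply npow_1.
    + right; apply l1_dirac.
  - destruct (Ap_rep_conv _ _ _ _ H IH1) as [A B]. split; auto.
    eapply Rle_trans; [exact B|]. apply Rmult_le_compat_l; auto.
    apply l1norm_nonneg, H.
Qed.

(** The weights are left general so that the exponential series, its head and its tail are all
    instances. *)
Lemma Ap_rep_power_series (w : nat -> R) (a : nat -> C) (f : C -> C) :
  (forall k, 0 <= w k) -> ex_series (fun k => w k * l1norm a ^ k) -> Ap_rep a f ->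
  Ap_rep (superp (fun k => RtoC (w k)) (conv_pow a))
    (fun s => CSeries (fun k => Cmult (w k) (Cpow (f s) k))) /\
  l1norm (superp (fun k => RtoC (w k)) (conv_pow a)) <= Series (fun k => w k * l1norm a ^ k).
Proof.
  intros Hw Hs H.
  assert (E : forall k, 0 <= Cmod (w k) * l1norm (conv_pow a k) <= w k * l1norm a ^ k).
  { intro k. rewrite Cmod_R, Rabs_pos_eq; auto.
    destruct (Ap_rep_conv_pow a f k H) as [[A _] B].
    generalize (Hw k) (l1norm_nonneg _ A). split; nra. }
  destruct (Ap_rep_superp (fun k => RtoC (w k)) (conv_pow a) (fun k s => Cpow (f s) k)) as [A B].
  - intro k; now apply Ap_rep_conv_pow.
  - apply ex_series_le_R with (2 := Hs). intro k. rewrite Rabs_pos_eq; apply E.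
  - split; auto. eapply Rle_trans; [exact B|]. now apply Series_le.
Qed.

Lemma Ap_rep_cexp (a : nat -> C) (f : C -> C) : Ap_rep a f ->
  exists E, Ap_rep E (fun s => cexp (f s)) /\ l1norm E <= exp (l1norm a).
Proof.
  intro H. assert (X := is_series_exp (l1norm a)).
  destruct (Ap_rep_power_series (fun k => / INR (fact k)) a f) as [A B]; auto.
  - intro; left; apply Rinv_0_lt_compat, INR_fact_lt_0.
  - now exists (exp (l1norm a)).
  - rewrite (is_series_unique _ _ X) in B. eexists; split; [|exact B].
    apply Ap_rep_ext with (2 := A). intros; now rewrite cexp_series.
Qed.

(** * Exponentials of Dirichlet polynomials and decay of [n^-phi] *)

Lemma exp_pow_nat (x : R) (k : nat) : exp x ^ k = exp (INR k * x).
Proof.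
  induction k as [|k IH]; [simpl; now rewrite Rmult_0_l, exp_0|].
  rewrite S_INR. simpl. rewrite IH, <- exp_plus. f_equal; ring.
Qed.

Definition exp_tail (K k : nat) : R := if Nat.ltb K k then / INR (fact k) else 0.

Lemma exp_tail_nonneg (K k : nat) : 0 <= exp_tail K k.
Proof.
  unfold exp_tail. destruct (Nat.ltb K k); [|lra].
  left; apply Rinv_0_lt_compat, INR_fact_lt_0.
Qed.

(** For [k > K] the factor [exp (k - K)] is at least 1; inserting it turns the tail into a part of
    [exp (- K)] times the full series at [exp 1 * x]. *)
Lemma exp_tail_bound (K : nat) (x : R) : 0 <= x ->
  ex_series (fun k => exp_tail K k * x ^ k) /\
  Series (fun k => exp_tail K k * x ^ k) <= exp (exp 1 * x - INR K).
Proof.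
  intro Hx.
  assert (T := is_series_exp (exp 1 * x)).
  assert (U : is_series (fun k => exp (- INR K) * (/ INR (fact k) * (exp 1 * x) ^ k))
                (exp (- INR K) * exp (exp 1 * x))) by exact (is_series_scal_l _ _ _ T).
  assert (H : forall k, 0 <= exp_tail K k * x ^ k <=
    exp (- INR K) * (/ INR (fact k) * (exp 1 * x) ^ k)).
  { intro k. assert (F : 0 < / INR (fact k)) by apply Rinv_0_lt_compat, INR_fact_lt_0.
    assert (P : 0 <= x ^ k) by now apply pow_le.
    split; [apply Rmult_le_pos; auto using exp_tail_nonneg|].
    rewrite Rpow_mult_distr, exp_pow_nat, Rmult_1_r.
    replace (exp (- INR K) * _) with (/ INR (fact k) * x ^ k * exp (INR k - INR K)).
    2:{ replace (INR k - INR K) with (- INR K + INR k) by ring. rewrite exp_plus. ring. }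
    assert (Q := exp_pos (INR k - INR K)).
    unfold exp_tail. destruct (Nat.ltb_spec K k) as [L|L].
    - apply lt_INR in L. assert (1 <= exp (INR k - INR K)).
      { rewrite <- exp_0. left; apply exp_increasing; lra. }
      assert (0 <= / INR (fact k) * x ^ k) by (apply Rmult_le_pos; lra). nra.
    - rewrite Rmult_0_l. apply Rmult_le_pos; [apply Rmult_le_pos|]; lra. }
  split.
  - apply ex_series_le_R with (2 := ex_intro _ _ U). intro k. rewrite Rabs_pos_eq; apply H.
  - eapply Rle_trans; [apply Series_le; [exact H | exact (ex_intro _ _ U)]|].
    rewrite (is_series_unique _ _ U), <- exp_plus. right; f_equal; ring.
Qed.

Fixpoint prod_pow (e : nat -> nat) (N : nat) : nat :=
  match N with O => 1 | S N' => prod_pow e N' * (S N') ^ (e N') end.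

Fixpoint prod_pow_list (N K : nat) : list nat :=
  match N with
  | O => 1%nat :: nil
  | S N' => flat_map (fun x => map (fun i => (x * (S N') ^ i)%nat) (seq 0 (S K))) (prod_pow_list N' K)
  end.

Lemma length_prod_pow_list (N K : nat) : length (prod_pow_list N K) = (S K ^ N)%nat.
Proof.
  induction N; [reflexivity|]. cbn [prod_pow_list].
  rewrite (flat_map_constant_length (c := S K)).
  - rewrite IHN. simpl. lia.
  - intros. now rewrite length_map, length_seq.
Qed.

Lemma in_prod_pow_list (N K : nat) (e : nat -> nat) :
  (forall i, (e i <= K)%nat) -> In (prod_pow e N) (prod_pow_list N K).
Proof.
  intro He. induction N; [left; reflexivity|].
  cbn [prod_pow prod_pow_list]. apply in_flat_map. eexists; split; [exact IHN|].
  apply in_map_iff. exists (e N). split; auto. apply in_seq. specialize (He N). lia.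
Qed.

Lemma prod_pow_incr (e : nat -> nat) (i N : nat) : (i < N)%nat ->
  prod_pow (fun j => if Nat.eqb j i then S (e j) else e j) N = (S i * prod_pow e N)%nat.
Proof.
  assert (E : forall M, (M <= i)%nat ->
    prod_pow (fun j => if Nat.eqb j i then S (e j) else e j) M = prod_pow e M).
  { induction M; intro HM; cbn [prod_pow]; auto. rewrite IHM by lia.
    destruct (Nat.eqb_spec M i); [lia|reflexivity]. }
  induction N; intro HN; [lia|]. cbn [prod_pow].
  destruct (Nat.eqb_spec N i) as [->|HNi].
  - rewrite E by lia. cbn [Nat.pow]. lia.
  - rewrite IHN by lia. lia.
Qed.

(** Each factor [a] multiplies the integer by some [n+1 <= N], which raises one exponent by one. *)
Lemma conv_pow_support (a : nat -> C) (N k m : nat) :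
  (forall j, (N <= j)%nat -> a j = 0) -> conv_pow a k m <> 0 ->
  exists e, (forall i, (e i <= k)%nat) /\ S m = prod_pow e N.
Proof.
  intro Ha. revert m. induction k as [|k IH]; intros m Hm.
  - exists (fun _ => O). split; auto. cbn [conv_pow] in Hm. unfold dirac in Hm.
    destruct (Nat.eqb_spec m 0) as [E|]; [rewrite E|congruence].
    clear. induction N; cbn [prod_pow]; [reflexivity|]. rewrite <- IHN. reflexivity.
  - apply NNPP; intro Hn. apply Hm. apply conv_eq_0. intros n j Hna Hj E. apply Hn.
    destruct (IH j Hj) as [e [He1 He2]].
    assert (L : (n < N)%nat).
    { destruct (Nat.lt_ge_cases n N); auto. exfalso; auto. }
    exists (fun i => if Nat.eqb i n then S (e i) else e i). split.
    + intro i. specialize (He1 i). destruct (Nat.eqb i n); lia.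
    + rewrite prod_pow_incr, <- He2 by auto. exact E.
Qed.

(** [|u|] is dominated by the sum, over the entries of [L], of point masses [B]; a repeated entry
    only enlarges the majorant. *)
Lemma l1norm_list_support (u : nat -> C) (L : list nat) (B : R) : 0 <= B ->
  (forall m, Cmod (u m) <= B) -> (forall m, u m <> 0 -> In (S m) L) ->
  l1norm u <= B * INR (length L).
Proof.
  intros HB Hu HL.
  set (w := fun m => fold_right (fun l r => (if Nat.eqb m (pred l) then B else 0) + r) 0 L).
  assert (W : is_series w (B * INR (length L))).
  { unfold w. clear. induction L as [|l L IH].
    - simpl. rewrite Rmult_0_r. apply is_series_ext with (2 := is_series_single 0 0).
      intro n; now destruct (Nat.eqb n 0).
    - cbn [fold_right length].
      replace (B * INR (S (length L))) with (B + B * INR (length L)) by (rewrite S_INR; ring).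
      exact (is_series_plus _ _ _ _ (is_series_single (pred l) B) IH). }
  assert (H : forall m, Cmod (u m) <= w m).
  { intro m. assert (P : 0 <= w m).
    { unfold w. clear -HB. induction L; cbn [fold_right]; [lra|].
      destruct (Nat.eqb m (pred a)); lra. }
    destruct (classic (u m = 0)) as [->|E]; [now rewrite Cmod_0|].
    apply Rle_trans with (1 := Hu m). apply HL in E. unfold w. clear -E HB.
    assert (G : forall L, 0 <= fold_right (fun l r => (if Nat.eqb m (pred l) then B else 0) + r) 0 L).
    { induction L0; cbn [fold_right]; [lra|]. destruct (Nat.eqb m (pred a)); lra. }
    induction L as [|l L IH]; [contradiction|]. cbn [fold_right].
    destruct E as [->|E].
    - simpl pred. rewrite Nat.eqb_refl. specialize (G L); lra.
    - specialize (IH E). destruct (Nat.eqb m (pred l)); lra. }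
  rewrite <- (is_series_unique _ _ W).
  apply l1_le; [exact H | exists (B * INR (length L)); exact W].
Qed.

Lemma exp_le_compat (x y : R) : x <= y -> exp x <= exp y.
Proof. intros [H| ->]; [left; now apply exp_increasing | right; reflexivity]. Qed.

(* The head of the exponential series has at most [(K+1)^N] nonzero coefficients, each of
   which Bohr's inequality controls by the supremum of [cexp f]. *)
Lemma l1norm_cexp_Dirichlet_polynomial (a : nat -> C) (f : C -> C) (N K : nat) (M k : R) :
  Ap_rep a f -> (forall j, (N <= j)%nat -> a j = 0) -> 0 <= k ->
  (forall s, 0 < Re s -> Re (f s) <= - M + k * Re s) ->
  exp 1 * l1norm a + M <= INR K ->
  exists E, Ap_rep E (fun s => cexp (f s)) /\ l1norm E <= 3 * INR (S K) ^ N * exp (- M).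
Proof.
  intros H Ha Hk Hre HK.
  assert (Hx := l1norm_nonneg a (proj1 H)).
  set (h := fun j => / INR (fact j) - exp_tail K j).
  assert (Hh : forall j, 0 <= h j <= / INR (fact j)).
  { intro j. assert (0 < / INR (fact j)) by apply Rinv_0_lt_compat, INR_fact_lt_0.
    unfold h, exp_tail. destruct (Nat.ltb K j); lra. }
  assert (Xh : ex_series (fun j => h j * l1norm a ^ j)).
  { apply ex_series_le_R with (2 := ex_intro _ _ (is_series_exp (l1norm a))).
    intro j. assert (0 <= l1norm a ^ j) by now apply pow_le.
    specialize (Hh j). rewrite Rabs_pos_eq by nra. nra. }
  destruct (exp_tail_bound K (l1norm a) Hx) as [Xt Bt].
  destruct (Ap_rep_power_series h a f (fun j => proj1 (Hh j)) Xh H) as [Ah _].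
  destruct (Ap_rep_power_series (exp_tail K) a f (exp_tail_nonneg K) Xt H) as [At Nt].
  set (Eh := superp (fun j => RtoC (h j)) (conv_pow a)) in *.
  set (Et := superp (fun j => RtoC (exp_tail K j)) (conv_pow a)) in *.
  assert (NT : l1norm Et <= exp (- M)).
  { eapply Rle_trans; [exact Nt|]. eapply Rle_trans; [exact Bt|].
    apply exp_le_compat. lra. }
  assert (SP : forall s, 0 < Re s ->
    cexp (f s) = Cplus (CSeries (fun j => Cmult (h j) (Cpow (f s) j)))
                       (CSeries (fun j => Cmult (exp_tail K j) (Cpow (f s) j)))).
  { intros s Hs. rewrite cexp_series.
    assert (Q : forall w : nat -> R, (forall j, 0 <= w j <= / INR (fact j)) ->
      l1 (fun j => Cmult (w j) (Cpow (f s) j))).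
    { intros w Hw. apply (l1_le _ _) with (2 := l1_exp_terms (f s)). intro j.
      rewrite !Cmod_mult, !Cmod_R, !Rabs_pos_eq; try (generalize (Hw j); lra).
      apply Rmult_le_compat_r; [apply Cmod_ge_0 | apply Hw]. }
    rewrite <- CSeries_plus.
    - apply CSeries_ext; intro j. rewrite <- Cmult_plus_distr_r, <- RtoC_plus.
      unfold h. do 2 f_equal. ring.
    - now apply Q.
    - apply Q. intro j. split; [apply exp_tail_nonneg|]. specialize (Hh j). unfold h in Hh. lra. }
  (* The head is [cexp f] minus the tail, and each of the two is at most
     [exp (- M) * exp (k * Re s)], by the hypothesis on [Re f] and by the choice of [K]. With the
     norm of the tail itself, this makes the constant 3. *)
  assert (Eb : forall m, Cmod (Eh m) <= 2 * exp (- M)).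
  { intro m. apply (coef_bound _ _ _ k m Ah). intros s Hs.
    replace (CSeries _) with (Cplus (cexp (f s))
      (Copp (CSeries (fun j => Cmult (exp_tail K j) (Cpow (f s) j))))) by (rewrite SP; auto; ring).
    eapply Rle_trans; [apply Cmod_triangle|]. rewrite Cmod_opp, Cmod_cexp.
    assert (T := Cmod_Ap_rep _ _ s At Hs). simpl in T.
    assert (1 <= exp (k * Re s)).
    { rewrite <- exp_0. apply exp_le_compat. apply Rmult_le_pos; lra. }
    assert (exp (Re (f s)) <= exp (- M) * exp (k * Re s)).
    { rewrite <- exp_plus. apply exp_le_compat; auto. }
    generalize (exp_pos (- M)). nra. }
  assert (Sp : forall m, Eh m <> 0 -> In (S m) (prod_pow_list N K)).
  { intros m Hm. apply NNPP; intro Hn. apply Hm. apply CSeries_0. intro j.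
    destruct (Nat.lt_ge_cases K j) as [L|L].
    - replace (h j) with 0; [apply Cmult_0_l|]. unfold h, exp_tail.
      destruct (Nat.ltb_spec K j); [ring|lia].
    - destruct (classic (conv_pow a j m = 0)) as [->|E]; [apply Cmult_0_r|].
      exfalso. destruct (conv_pow_support a N j m Ha E) as [e [He Em]].
      apply Hn. rewrite Em. apply in_prod_pow_list. intro i; specialize (He i); lia. }
  exists (fun m => Cplus (Eh m) (Et m)). split.
  - apply Ap_rep_ext with (2 := Ap_rep_plus _ _ _ _ Ah At). intros s Hs. now rewrite SP.
  - eapply Rle_trans; [apply l1_plus; [apply Ah | apply At]|].
    assert (P := exp_pos (- M)).
    assert (B := l1norm_list_support Eh _ (2 * exp (- M)) ltac:(lra) Eb Sp).
    rewrite length_prod_pow_list, pow_INR in B.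
    assert (1 <= INR (S K) ^ N).
    { apply pow_R1_Rle. rewrite S_INR. generalize (pos_INR K); lra. }
    nra.
Qed.

(** The [N]-th power of [mu * x <= exp (mu * x)]. A small [mu] makes the polynomial count of
    coefficients cost only a small power of [n]. *)
Lemma pow_le_exp (x : R) (N : nat) (mu : R) : 0 <= x -> 0 < mu ->
  x ^ N <= (/ mu) ^ N * exp (INR N * (mu * x)).
Proof.
  intros Hx Hmu. rewrite <- exp_pow_nat, <- Rpow_mult_distr.
  apply pow_incr. split; auto.
  assert (H := exp_ineq1_le (mu * x)).
  assert (P : 0 < / mu) by now apply Rinv_0_lt_compat.
  apply Rle_trans with (/ mu * (1 + mu * x)); [|nra].
  rewrite Rmult_plus_distr_l, <- Rmult_assoc, Rinv_l; lra.
Qed.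

Lemma Dir_plus (a b : nat -> C) (s : C) : l1 a -> l1 b -> 0 < Re s ->
  Dir (fun k => Cplus (a k) (b k)) s = Cplus (Dir a s) (Dir b s).
Proof.
  intros Ha Hb Hs. symmetry.
  apply (Ap_rep_plus _ _ _ _ (Ap_rep_Dir a Ha) (Ap_rep_Dir b Hb)). exact Hs.
Qed.

Lemma npow_scal_INR (n k : nat) (s : C) : (0 < n)%nat ->
  npow n (Cmult (INR k) s) = npow (n ^ k) s.
Proof.
  intro Hn. rewrite npow_pow by auto. induction k as [|k IH].
  - simpl. rewrite Cmult_0_l. unfold npow. rewrite <- cexp_0. f_equal. ring.
  - rewrite S_INR, RtoC_plus, Cmult_plus_distr_r, npow_plus, IH, Cmult_1_l. simpl. ring.
Qed.

(** Budget for the exponent, in units of [t = ln n]: the polynomial part keeps the decay [3 d / 4];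
    the exponential of the remainder [r] costs [d / 4], the count of coefficients another [d / 4],
    and [d / 4] is left. *)
Lemma npow_affine_rep (c : nat -> C) (c0 : nat) (d : R) : l1 c -> 0 < d ->
  (forall s, 0 < Re s -> d < Re (Cplus (Cmult (INR c0) s) (Dir c s))) ->
  exists B, forall n, (1 <= n)%nat ->
    exists E, Ap_rep E (fun s => npow n (Cplus (Cmult (INR c0) s) (Dir c s))) /\
      l1norm E <= B * exp (- (d / 4 * ln (INR n))).
Proof.
  intros Hc Hd Hre.
  destruct (l1_tail_small c (d / 4) Hc ltac:(lra)) as [N HN]. specialize (HN N ltac:(lia)).
  set (p := fun j => if Nat.ltb j N then c j else 0).
  set (r := fun j => if Nat.ltb j N then RtoC 0 else c j).
  assert (Hp : l1 p).
  { apply (l1_le p _) with (2 := Hc). intro j. unfold p.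
    destruct (Nat.ltb j N); [lra|]. rewrite Cmod_0. apply Cmod_ge_0. }
  assert (Hr : l1 r).
  { apply (l1_le r _) with (2 := Hc). intro j. unfold r.
    destruct (Nat.ltb j N); [|lra]. rewrite Cmod_0. apply Cmod_ge_0. }
  assert (Nr : l1norm r < d / 4).
  { unfold l1norm. rewrite (Series_incr_n_aux _ N).
    - rewrite (Series_ext _ (fun k => Cmod (c (N + k)%nat))); [exact HN|].
      intro k. unfold r. destruct (Nat.ltb_spec (N + k) N); [lia|reflexivity].
    - intros k Hk. unfold r. destruct (Nat.ltb_spec k N); [apply Cmod_0|lia]. }
  assert (Hpr : forall s, 0 < Re s -> Dir c s = Cplus (Dir p s) (Dir r s)).
  { intros s Hs. rewrite <- Dir_plus; auto. f_equal. apply functional_extensionality.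
    intro j. unfold p, r. destruct (Nat.ltb j N); ring. }
  (* The truncation order must be at least [exp 1 * t ||p|| + 3 d t / 4], which is [L * t]. *)
  set (L := exp 1 * l1norm p + 3 * d / 4).
  assert (PL : 0 < L).
  { unfold L. generalize (l1norm_nonneg p Hp) (exp_pos 1). nra. }
  (* Chosen so that [N * mu * L <= d / 4]; [S N] in place of [N] avoids a division by zero when
     [N = 0]. *)
  set (mu := / (INR (S N) * L) * (d / 4)).
  assert (Pmu : 0 < mu).
  { unfold mu. apply Rmult_lt_0_compat; [|lra]. apply Rinv_0_lt_compat.
    apply Rmult_lt_0_compat; auto. apply lt_0_INR; lia. }
  (* The 2 comes from [K + 1 <= L * t + 2], where [K] is one more than the integer part of
     [L * t]. *)
  exists (3 * (/ mu) ^ N * exp (INR N * (mu * 2))).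
  intros n Hn. set (t := ln (INR n)).
  assert (Ht : 0 <= t).
  { unfold t. destruct n; [lia|]. apply ln_INR_S_nonneg. }
  destruct (nfloor_ex (L * t)) as [K0 [HK1 HK2]]; [apply Rmult_le_pos; lra|].
  assert (AP := Ap_rep_scal (- t)%R _ _ (Ap_rep_Dir p Hp)).
  assert (AR := Ap_rep_scal (- t)%R _ _ (Ap_rep_Dir r Hr)).
  assert (NP : l1norm (fun k => Cmult (- t)%R (p k)) = t * l1norm p).
  { rewrite (proj2 (l1_scal _ _ Hp)), Cmod_R, Rabs_Ropp, Rabs_pos_eq; auto. }
  assert (NR : l1norm (fun k => Cmult (- t)%R (r k)) = t * l1norm r).
  { rewrite (proj2 (l1_scal _ _ Hr)), Cmod_R, Rabs_Ropp, Rabs_pos_eq; auto. }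
  destruct (l1norm_cexp_Dirichlet_polynomial _ _ N (S K0) (3 * d / 4 * t) (INR c0 * t) AP)
    as [E1 [A1 B1]].
  - intros j Hj. unfold p. destruct (Nat.ltb_spec j N); [lia|]. apply Cmult_0_r.
  - apply Rmult_le_pos; auto. apply pos_INR.
  - intros s Hs. rewrite re_scal_l. specialize (Hre s Hs).
    rewrite re_plus, re_scal_l, Hpr, re_plus in Hre; auto.
    assert (R1 := Cmod_Dir r s Hr ltac:(lra)).
    assert (R2 := re_le_Cmod (Dir r s)). apply Rabs_le_between in R2.
    assert (3 * d / 4 <= INR c0 * Re s + Re (Dir p s)) by lra. nra.
  - rewrite NP, S_INR. unfold L in HK2. nra.
  - destruct (Ap_rep_cexp _ _ AR) as [E2 [A2 B2]]. rewrite NR in B2.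
    destruct (Ap_rep_conv _ _ _ _ A1 A2) as [A3 B3].
    (* The factor [n^(-c0 s)] is [(n^c0)^-s], a mere dilation of the indices, which does not
       increase the norm. *)
    assert (Z : exists k, (n ^ c0 = S k)%nat).
    { assert (n ^ c0 <> 0)%nat by (apply Nat.pow_nonzero; lia).
      exists (pred (n ^ c0)). lia. }
    destruct Z as [k Hk].
    destruct (Ap_rep_shift k _ _ A3) as [A4 B4].
    eexists. split.
    + apply Ap_rep_ext with (2 := A4). intros s Hs. cbv beta.
      rewrite npow_plus, npow_scal_INR, Hk by lia. f_equal.
      rewrite <- cexp_plus, Hpr by auto. unfold npow. f_equal. fold t.
      rewrite RtoC_opp. ring.
    + eapply Rle_trans; [exact B4|]. eapply Rle_trans; [exact B3|].
      apply Rle_trans with ((3 * INR (S (S K0)) ^ N * exp (- (3 * d / 4 * t))) * exp (d / 4 * t)).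
      { apply Rmult_le_compat; auto.
        - apply l1norm_nonneg, A1.
        - apply l1norm_nonneg, A2.
        - eapply Rle_trans; [exact B2|]. apply exp_le_compat. nra. }
      apply Rle_trans with ((3 * ((/ mu) ^ N * exp (INR N * (mu * (L * t + 2))))
           * exp (- (3 * d / 4 * t))) * exp (d / 4 * t)).
      { apply Rmult_le_compat_r; [left; apply exp_pos|].
        apply Rmult_le_compat_r; [left; apply exp_pos|].
        apply Rmult_le_compat_l; [lra|].
        apply Rle_trans with ((L * t + 2) ^ N).
        - apply pow_incr. split; [apply pos_INR|]. rewrite !S_INR. lra.
        - apply pow_le_exp; auto. assert (0 <= L * t) by (apply Rmult_le_pos; lra). lra. }
      replace (_ * exp (- (3 * d / 4 * t)) * exp (d / 4 * t)) with
        (3 * (/ mu) ^ N * (exp (INR N * (mu * (L * t + 2))) *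
           (exp (- (3 * d / 4 * t)) * exp (d / 4 * t)))) by ring.
      rewrite <- !exp_plus, (Rmult_assoc _ (exp (INR N * (mu * 2))) _), <- exp_plus.
      apply Rmult_le_compat_l.
      { apply Rmult_le_pos; [lra|]. apply pow_le. left; now apply Rinv_0_lt_compat. }
      apply exp_le_compat.
      assert (X : INR N * (mu * L) <= d / 4).
      { unfold mu. replace (INR N * (/ (INR (S N) * L) * (d / 4) * L))
          with (INR N / INR (S N) * (d / 4)).
        - rewrite S_INR. assert (0 <= INR N) by apply pos_INR.
          assert (INR N / (INR N + 1) <= 1).
          { apply Rmult_le_reg_r with (INR N + 1); [lra|]. unfold Rdiv.
            rewrite Rmult_assoc, Rinv_l; lra. }
          nra.
        - field. split; [lra | apply not_0_INR; lia]. }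
      nra.
Qed.

(** * Uniform boundedness *)

Lemma choice_fun {A B : Type} (P : A -> B -> Prop) :
  (forall x, exists y, P x y) -> exists f, forall x, P x (f x).
Proof.
  intro H. exists (fun x => proj1_sig (constructive_indefinite_description _ (H x))).
  intro x. apply proj2_sig.
Qed.

Lemma sum_f_R0_triangle (u v : nat -> C) (N : nat) :
  sum_f_R0 (fun m => Cmod (Cplus (u m) (v m))) N <=
  sum_f_R0 (fun m => Cmod (u m)) N + sum_f_R0 (fun m => Cmod (v m)) N.
Proof.
  rewrite <- sum_plus. apply sum_Rle. intros; apply Cmod_triangle.
Qed.

Lemma ex_series_third (k : nat) : ex_series (fun j => (/ 3) ^ (k + j)) /\
  Series (fun j => (/ 3) ^ (k + j)) = 3 / 2 * (/ 3) ^ k.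
Proof.
  assert (G : is_series (fun j => (/ 3) ^ j) (/ (1 - / 3))).
  { apply is_series_geom. rewrite Rabs_pos_eq; lra. }
  assert (H : is_series (fun j => (/ 3) ^ k * (/ 3) ^ j) ((/ 3) ^ k * / (1 - / 3)))
    by exact (is_series_scal_l _ _ _ G).
  split.
  - eexists. apply is_series_ext with (2 := H). intro; now rewrite pow_add.
  - rewrite (Series_ext _ (fun j => (/ 3) ^ k * (/ 3) ^ j)) by (intro; apply pow_add).
    rewrite (is_series_unique _ _ H). field.
Qed.

(* Sokal's gliding hump: the signs of the terms [3^-k B (nu k)] are chosen so that the partial
   sums do not cancel on the window where [B (nu k)] is large. *)
Lemma uniform_boundedness (B : nat -> nat -> C) :
  (forall n m, Cmod (B n m) <= 1) -> (forall n, l1 (B n)) ->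
  (forall (nu : nat -> nat) (eps : nat -> R), (forall k, Rabs (eps k) <= (/ 3) ^ k) ->
    exists beta, l1 beta /\ forall m, beta m = CSeries (fun k => Cmult (eps k) (B (nu k) m))) ->
  exists K, forall n, l1norm (B n) <= K.
Proof.
  intros HB Hl Hsup. apply NNPP; intro Hno.
  set (p := fun N n => sum_f_R0 (fun m => Cmod (B n m)) N).
  assert (Hp : forall N n, 0 <= p N n <= INR (S N)).
  { intros N n. split; [apply cond_pos_sum; intro; apply Cmod_ge_0|].
    rewrite <- (Rmult_1_l (INR (S N))), <- sum_cte. apply sum_Rle. auto. }
  (* The window must make its own hump large and also nearly maximal among all [n], so that later
     terms cannot outweigh it there. The supremum over [n] is finite because entries of modulus at
     most 1 bound [p N] by [N + 1]. *)
  assert (Hc : forall k : nat, exists Nn : nat * nat,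
    2 / 3 * 4 ^ k < p (fst Nn) (snd Nn) /\
    forall n, 2 / 3 * p (fst Nn) n <= p (fst Nn) (snd Nn)).
  { intro k.
    assert (H : exists N n, 4 ^ k < p N n).
    { apply NNPP; intro Hn. apply Hno. exists (4 ^ k). intro n.
      apply Series_nonneg_bound; [intro; apply Cmod_ge_0|]. intro N.
      apply Rnot_lt_le. intro L. apply Hn. exists N, n. exact L. }
    destruct H as [N [n0 H]].
    destruct (completeness (fun x => exists n, x = p N n)) as [W [W1 W2]].
    - exists (INR (S N)). intros x [n ->]. apply Hp.
    - exists (p N n0), n0. reflexivity.
    - assert (W0 : p N n0 <= W) by (apply W1; exists n0; reflexivity).
      assert (P4 : 0 < 4 ^ k) by (apply pow_lt; lra).
      assert (T : exists n, 2 / 3 * W < p N n).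
      { apply NNPP; intro Hn. assert (W <= 2 / 3 * W); [|lra].
        apply W2. intros x [n ->]. apply Rnot_lt_le. intro L. apply Hn. now exists n. }
      destruct T as [n T]. exists (N, n). simpl. split; [lra|].
      intro n'. assert (p N n' <= W) by (apply W1; exists n'; reflexivity). lra. }
  destruct (choice_fun _ Hc) as [sel Hsel]. clear Hc.
  set (Nf := fun k => fst (sel k)). set (nu := fun k => snd (sel k)).
  set (q := fun k u => sum_f_R0 (fun m => Cmod (u m)) (Nf k)).
  set (e := fun k (r : R) (m : nat) => Cmult r (B (nu k) m)).
  (* The sign at stage [k] depends on the partial sum already built, so the signs and the partial
     sums [X] are produced by one recursion. *)
  set (sg := fun k (u : nat -> C) =>
    if Rle_dec ((/ 3) ^ k * p (Nf k) (nu k)) (q k (fun m => Cplus (u m) (e k ((/ 3) ^ k) m)))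
    then (/ 3) ^ k else - (/ 3) ^ k).
  set (X := fix X k : nat -> C := match k with
    | O => fun _ => RtoC 0
    | S k' => fun m => Cplus (X k' m) (e k' (sg k' (X k')) m) end).
  set (eps := fun k => sg k (X k)).
  assert (Pk : forall k, 0 < (/ 3) ^ k) by (intro; apply pow_lt; lra).
  assert (Heps : forall k, Rabs (eps k) <= (/ 3) ^ k).
  { intro k. unfold eps, sg. specialize (Pk k).
    destruct (Rle_dec _ _); [rewrite Rabs_pos_eq | rewrite Rabs_Ropp, Rabs_pos_eq]; lra. }
  assert (HX : forall k m, X k m = csum (fun j => Cmult (eps j) (B (nu j) m)) k).
  { induction k; intro m; [reflexivity|]. simpl. rewrite IHk. reflexivity. }
  (* The two candidates [u + e] and [u - e] differ by [2 e], so one of them has size at least that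
     of [e] on the window. *)
  assert (HqX : forall k, (/ 3) ^ k * p (Nf k) (nu k) <= q k (X (S k))).
  { intro k. simpl X. set (u := X k). unfold sg.
    destruct (Rle_dec _ _) as [L|L]; [exact L|]. apply Rnot_le_lt in L.
    assert (T : q k (fun m => Cplus (Cplus (u m) (e k ((/ 3) ^ k) m))
                   (Copp (Cplus (u m) (e k (- (/ 3) ^ k) m)))) <=
       q k (fun m => Cplus (u m) (e k ((/ 3) ^ k) m)) +
       q k (fun m => Cplus (u m) (e k (- (/ 3) ^ k) m))).
    { unfold q. eapply Rle_trans; [apply sum_f_R0_triangle|].
      apply Rplus_le_compat_l. right. apply sum_eq. intros; apply Cmod_opp. }
    assert (Eq : q k (fun m => Cplus (Cplus (u m) (e k ((/ 3) ^ k) m))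
                   (Copp (Cplus (u m) (e k (- (/ 3) ^ k) m)))) =
       2 * (/ 3) ^ k * p (Nf k) (nu k)).
    { unfold q, p. rewrite scal_sum. apply sum_eq. intros m _. unfold e.
      replace (Cplus _ _) with (Cmult (2 * (/ 3) ^ k)%R (B (nu k) m)).
      - rewrite Cmod_mult, Cmod_R, Rabs_pos_eq; [ring|]. specialize (Pk k); lra.
      - rewrite RtoC_opp, RtoC_mult. ring. }
    lra. }
  destruct (Hsup nu eps Heps) as [beta [Hb1 Hb2]].
  (* On window [k] later terms contribute at most [3/2 * 3/2 * 3^-(k+1) = 3/4 * 3^-k] times [p]. A
     quarter of [3^-k p] survives, and [p > 2/3 * 4^k] gives the constant [1/6]. *)
  assert (Hlow : forall k, / 6 * (4 / 3) ^ k <= l1norm beta).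
  { intro k.
    apply Rle_trans with (q k beta).
    2:{ apply (sum_le_Series (fun m => Cmod (beta m))); auto. intro; apply Cmod_ge_0. }
    set (tl := fun j m => Cmult (eps (S k + j)%nat) (B (nu (S k + j)%nat) m)).
    destruct (ex_series_third (S k)) as [G1 G2].
    assert (Hall : forall m, l1 (fun j => Cmult (eps j) (B (nu j) m))).
    { intro m. apply (l1_le _ _) with (2 := proj1 (ex_series_third 0)). intro j.
      rewrite Cmod_mult, Cmod_R. specialize (HB (nu j) m). specialize (Heps j).
      generalize (Rabs_pos (eps j)) (Cmod_ge_0 (B (nu j) m)). simpl. nra. }
    assert (Htl : forall m, l1 (fun j => tl j m) /\
      beta m = Cplus (X (S k) m) (CSeries (fun j => tl j m))).
    { intro m. rewrite Hb2, HX. apply (CSeries_csum_tail _ (S k) (Hall m)). }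
    assert (Q1 : q k (X (S k)) <= q k beta + q k (fun m => CSeries (fun j => tl j m))).
    { unfold q at 1. rewrite (sum_eq _ (fun m => Cmod (Cplus (beta m)
        (Copp (CSeries (fun j => tl j m)))))).
      - eapply Rle_trans; [apply sum_f_R0_triangle|]. apply Rplus_le_compat_l.
        right. apply sum_eq. intros; apply Cmod_opp.
      - intros m _. f_equal. rewrite (proj2 (Htl m)). ring. }
    assert (Q2 : q k (fun m => CSeries (fun j => tl j m)) <=
       3 / 2 * p (Nf k) (nu k) * (3 / 2 * (/ 3) ^ (S k))).
    { apply Rle_trans with (sum_f_R0 (fun m => Series (fun j => Cmod (tl j m))) (Nf k)).
      { apply sum_Rle. intros m _. apply Cmod_CSeries, Htl. }
      destruct (sum_f_R0_Series (fun j m => Cmod (tl j m)) (Nf k)) as [_ <-].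
      { intro m; apply Htl. }
      rewrite <- G2, <- Series_scal_l. apply Series_le.
      - intro j. split; [apply cond_pos_sum; intro; apply Cmod_ge_0|].
        apply Rle_trans with ((/ 3) ^ (S k + j) * p (Nf k) (nu (S k + j)%nat)).
        + unfold p. rewrite scal_sum. apply sum_Rle. intros m _.
          unfold tl. rewrite Cmod_mult, Cmod_R, Rmult_comm.
          apply Rmult_le_compat_l; [apply Cmod_ge_0 | apply Heps].
        + rewrite Rmult_comm. apply Rmult_le_compat_r; [left; apply Pk|].
          generalize (proj2 (Hsel k) (nu (S k + j)%nat)). fold (Nf k) (nu k). lra.
      - now apply ex_series_scal_R. }
    assert (Q3 := HqX k). assert (Q4 := proj1 (Hsel k)). fold (Nf k) (nu k) in Q4.
    replace ((4 / 3) ^ k) with (4 ^ k * (/ 3) ^ k) by (rewrite <- Rpow_mult_distr; f_equal; field).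
    simpl pow in Q2. specialize (Pk k). nra. }
  assert (L := is_lim_seq_geom_p (4 / 3) ltac:(lra)).
  apply is_lim_seq_spec in L. destruct (L (6 * l1norm beta)) as [N HN].
  specialize (HN N ltac:(lia)). specialize (Hlow N). lra.
Qed.

Lemma Ap_rep_csum (al : nat -> C) (b : nat -> nat -> C) (g : nat -> C -> C) (N : nat) :
  (forall n, Ap_rep (b n) (g n)) ->
  Ap_rep (fun m => csum (fun n => Cmult (al n) (b n m)) N)
    (fun s => csum (fun n => Cmult (al n) (g n s)) N).
Proof.
  intro H. induction N as [|N IH]; simpl.
  - apply Ap_rep_ext with (fun s => Cmult 0 (g O s)); [intros; ring|].
    replace (fun _ : nat => RtoC 0) with (fun m => Cmult 0 (b O m)).
    + now apply Ap_rep_scal.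
    + apply functional_extensionality; intro; ring.
  - apply Ap_rep_plus; auto. apply (Ap_rep_scal (al N) (b N) (g N)); auto.
Qed.

(** The norms of the [b n] are not known to be bounded here, so Fubini does not apply. Instead, the
    remainder of the series is uniformly small as a function, and Bohr's inequality transfers this
    to its [m]-th coefficient. *)
Lemma coef_CSeries (eps : nat -> C) (b : nat -> nat -> C) (g : nat -> C -> C)
    (beta : nat -> C) (m : nat) :
  l1 eps -> (forall n, Ap_rep (b n) (g n)) ->
  (forall n s, 0 < Re s -> Cmod (g n s) <= 1) ->
  Ap_rep beta (fun s => CSeries (fun n => Cmult (eps n) (g n s))) ->
  beta m = CSeries (fun n => Cmult (eps n) (b n m)).
Proof.
  intros He Hb Hg Hbeta.
  assert (Hw : forall w : nat -> C, (forall n, Cmod (w n) <= 1) ->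
    l1 (fun n => Cmult (eps n) (w n)) /\
    forall N, Cmod (CSeries (fun k => Cmult (eps (N + k)%nat) (w (N + k)%nat))) <=
      l1norm (fun k => eps (N + k)%nat)).
  { intros w Hw.
    assert (D : forall n, Cmod (Cmult (eps n) (w n)) <= Cmod (eps n)).
    { intro n. rewrite Cmod_mult. specialize (Hw n). generalize (Cmod_ge_0 (eps n)). nra. }
    split; [now apply (l1_le _ _ D)|]. intro N.
    destruct (l1_le (fun k => Cmult (eps (N + k)%nat) (w (N + k)%nat))
      (fun k => Cmod (eps (N + k)%nat))) as [T1 T2].
    - intro; apply D.
    - apply (CSeries_csum_tail eps N He).
    - eapply Rle_trans; [now apply Cmod_CSeries | exact T2]. }
  assert (Hbm : forall n, Cmod (b n m) <= 1) by (intro n; apply (coef_bound_sup _ _ _ _ (Hb n)); auto).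
  set (z := CSeries (fun n => Cmult (eps n) (b n m))).
  assert (Z : Cmod (Cminus (beta m) z) = 0).
  { apply Rle_antisym; [|apply Cmod_ge_0]. apply le_epsilon. intros d Hd.
    destruct (l1_tail_small eps (d / 2) He ltac:(lra)) as [N HN]. specialize (HN N ltac:(lia)).
    assert (Z1 : Cmod (Cminus (beta m) (csum (fun n => Cmult (eps n) (b n m)) N)) <= d / 2).
    { apply (coef_bound_sup _ _ _ m (Ap_rep_minus _ _ _ _ Hbeta (Ap_rep_csum eps b g N Hb))).
      intros s Hs. destruct (Hw (fun n => g n s)) as [W1 W2]; [intro; auto|].
      rewrite (proj2 (CSeries_csum_tail _ N W1)). specialize (W2 N).
      set (x := csum _ N). set (y := CSeries _).
      replace (Cminus (Cplus x y) x) with y by ring.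
      apply Rle_trans with (1 := W2). lra. }
    destruct (Hw (fun n => b n m) Hbm) as [W1 W2]. specialize (W2 N).
    unfold z. rewrite (proj2 (CSeries_csum_tail _ N W1)).
    set (x := csum _ N) in *.
    set (y := CSeries (fun k => Cmult (eps (N + k)%nat) (b (N + k)%nat m))) in *.
    replace (Cminus (beta m) (Cplus x y)) with (Cplus (Cminus (beta m) x) (Copp y)) by ring.
    eapply Rle_trans; [apply Cmod_triangle|]. rewrite Cmod_opp.
    apply Rle_trans with (d / 2 + d / 2); [|lra].
    apply Rplus_le_compat; [exact Z1 | apply Rle_trans with (1 := W2); lra]. }
  apply Cmod_eq_0 in Z. replace (beta m) with (Cplus (Cminus (beta m) z) z) by ring.
  rewrite Z. ring.
Qed.

Lemma comp_maps_npow_bounded (phi : C -> C) : comp_maps phi ->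
  (forall n, (1 <= n)%nat -> inAp (npow_phi phi n)) /\
  exists K, 0 < K /\ forall n, (1 <= n)%nat -> Apnorm (npow_phi phi n) <= K.
Proof.
  intros [Hre Hmap].
  assert (Hin : forall n, exists a, Ap_rep a (npow_phi phi (S n))).
  { intro n. destruct (Hmap (dirac n) (proj1 (l1_dirac n))) as [a Ha].
    exists a. apply Ap_rep_ext with (2 := Ha). intros s _. apply Dir_dirac. }
  split.
  { intros n Hn. destruct n; [lia|]. destruct (Hin n) as [a Ha]. now exists a. }
  destruct (choice_fun _ Hin) as [B HB].
  assert (Hg : forall n s, 0 < Re s -> Cmod (npow_phi phi (S n) s) <= 1)
    by (intros; apply Cmod_npow_le_1; auto).
  destruct (uniform_boundedness B) as [K HK].
  - intros n m. apply (coef_bound_sup _ _ _ m (HB n)). auto.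
  - intro n; apply HB.
  (* The sequence [beta] consists of the coefficients of [f o phi] for [f] the sum of the
     [eps_k (nu k + 1)^-s], which lies in A^+ because [eps] is summable. *)
  - intros nu eps Heps.
    assert (He : l1 (fun k => RtoC (eps k))).
    { apply (l1_le _ _) with (2 := proj1 (ex_series_third 0)). intro k.
      rewrite Cmod_R. apply Heps. }
    destruct (l1_superp (fun k => RtoC (eps k)) (fun k => dirac (nu k))) as (A & _ & D).
    + intro; apply l1_dirac.
    + apply ex_series_ext_R with (2 := He). intro k. rewrite (proj2 (l1_dirac _)). ring.
    + destruct (Hmap _ A) as [beta Hbeta]. exists beta. split; [apply Hbeta|].
      intro m. apply (coef_CSeries _ (fun k => B (nu k)) (fun k => npow_phi phi (S (nu k)))); auto.
      apply Ap_rep_ext with (2 := Hbeta). intros s Hs. unfold Ccomp. rewrite D by auto.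
      apply CSeries_ext; intro k. now rewrite Dir_dirac.
  - exists (Rmax 1 K). split; [apply Rlt_le_trans with 1; [lra | apply Rmax_l]|].
    intros n Hn. destruct n; [lia|]. rewrite (Apnorm_rep _ _ (HB n)).
    apply Rle_trans with (1 := HK n). apply Rmax_r.
Qed.

(** * Strict positivity of [Re phi] *)

Lemma ln_INR_unbounded (Y : R) : exists n, forall m, (n <= m)%nat -> Y <= ln (INR (S m)).
Proof.
  destruct (nfloor_ex (exp Y)) as [n [_ Hn]]; [left; apply exp_pos|].
  exists n. intros m Hm. rewrite <- (ln_exp Y). apply ln_le; [apply exp_pos|].
  apply le_INR in Hm. rewrite S_INR. lra.
Qed.

(** At [x = Y / (X k)], the inequality [exp (x k) >= 1 + x k] gives [X exp (x k) >= X + Y > Y]. *)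
Lemma exp_decay_contradiction (X Y k : R) : 0 < X -> 0 < k ->
  (forall x, 0 < x -> X <= Y * exp (- (x * k))) -> False.
Proof.
  intros HX Hk H.
  assert (HY : 0 < Y).
  { specialize (H 1 ltac:(lra)). generalize (exp_pos (- (1 * k))). nra. }
  set (x := Y / (X * k)).
  assert (Hx : 0 < x) by (unfold x; apply Rdiv_lt_0_compat; auto; nra).
  specialize (H x Hx).
  assert (P := exp_pos (x * k)). assert (Q := exp_ineq1_le (x * k)).
  apply (Rmult_le_compat_r (exp (x * k))) in H; [|lra].
  rewrite Rmult_assoc, <- exp_plus, Rplus_opp_l, exp_0 in H.
  assert (x * k * X = Y) by (unfold x; field; split; lra). nra.
Qed.

Lemma Cmod_Dir_tail (a : nat -> C) (N : nat) (s : C) : l1 a -> 0 <= Re s ->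
  (forall j, (j < N)%nat -> a j = 0) ->
  Cmod (Dir a s) <= exp (- (Re s * ln (INR (S N)))) * l1norm a.
Proof.
  intros Ha Hs H0.
  unfold l1norm. rewrite <- Series_scal_l.
  destruct (l1_le (dterm a s) (fun k => exp (- (Re s * ln (INR (S N)))) * Cmod (a k))) as [A B].
  - intro k. unfold dterm. rewrite Cmod_mult, Rmult_comm.
    destruct (Nat.lt_ge_cases k N) as [L|L].
    + rewrite H0 by auto. rewrite Cmod_0. lra.
    + apply Rmult_le_compat_r; [apply Cmod_ge_0|].
      rewrite Cmod_npow. apply exp_le_compat, Ropp_le_contravar, Rmult_le_compat_l; auto.
      apply ln_le; [apply lt_0_INR; lia | apply le_INR; lia].
  - now apply ex_series_scal_R.
  - eapply Rle_trans; [now apply Cmod_CSeries | exact B].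
Qed.

(** One of the rotations by [0], [pi], [pi / 2], [- pi / 2] is enough, according to the signs of the
    two parts of [z]. *)
Lemma exists_rotation (z : C) (lam : R) : z <> 0 -> 0 < lam ->
  exists t, 0 < Re (Cmult z (cis (- (lam * t)))).
Proof.
  intros Hz Hl.
  assert (E : forall th, Re (Cmult z (cis (- (lam * (- th / lam))))) =
    Re z * cos th - Im z * sin th).
  { intro th. replace (- (lam * (- th / lam))) with th by (field; lra).
    rewrite re_mult. reflexivity. }
  destruct (Rtotal_order (Re z) 0) as [H|[H|H]].
  - exists (- PI / lam). rewrite E, cos_PI, sin_PI. lra.
  - destruct (Rtotal_order (Im z) 0) as [K|[K|K]].
    + exists (- (PI / 2) / lam). rewrite E, cos_PI2, sin_PI2. lra.
    + exfalso. apply Hz. now apply C_ext.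
    + exists (- - (PI / 2) / lam). rewrite E, cos_neg, sin_neg, cos_PI2, sin_PI2. lra.
  - exists (- 0 / lam). rewrite E, cos_0, sin_0. lra.
Qed.

(* Far to the right the function is [a 0] plus its first nonzero term, and some choice of
   the imaginary part aligns that term with [a 0]. *)
Lemma Ap_rep_const (a : nat -> C) (f : C -> C) : Ap_rep a f ->
  (forall s, 0 < Re s -> Cmod (f s) <= 1) -> 1 <= Cmod (a O) ->
  forall s, 0 < Re s -> f s = a O.
Proof.
  intros Haf Hf H0.
  assert (Z : forall n, (1 <= n)%nat -> a n = 0).
  { intro n0. induction n0 as [n0 IH] using (well_founded_induction lt_wf). intro Hn.
    apply NNPP; intro Hnz.
    assert (Hl : 0 < ln (INR (S n0))).
    { rewrite <- ln_1. apply ln_increasing; [lra|]. apply lt_1_INR. lia. }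
    assert (Ha0 : a O <> 0). { intro E. rewrite E, Cmod_0 in H0. lra. }
    destruct (exists_rotation (Cdiv (a n0) (a O)) _ ltac:(intro E; apply Hnz;
      replace (a n0) with (Cmult (a O) (Cdiv (a n0) (a O))) by (field; auto);
      rewrite E; ring) Hl) as [t Ht].
    set (be := Cmult (Cdiv (a n0) (a O)) (cis (- (ln (INR (S n0)) * t)))) in *.
    set (c := fun k => if Nat.leb k n0 then RtoC 0 else a k).
    assert (Hc : l1 c).
    { apply (l1_le _ _) with (2 := proj1 Haf). intro k. unfold c.
      destruct (Nat.leb k n0); [rewrite Cmod_0; apply Cmod_ge_0 | lra]. }
    assert (Dec : forall s, 0 < Re s ->
      f s = Cplus (Cplus (a O) (Cmult (a n0) (npow (S n0) s))) (Dir c s)).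
    { intros s Hs.
      assert (R := Ap_rep_plus _ _ _ _ (Ap_rep_plus _ _ _ _
        (Ap_rep_scal (a O) _ _ (Ap_rep_npow 0)) (Ap_rep_scal (a n0) _ _ (Ap_rep_npow n0)))
        (Ap_rep_Dir c Hc)).
      rewrite (proj2 Haf s Hs).
      transitivity (Cplus (Cplus (Cmult (a O) (npow 1 s)) (Cmult (a n0) (npow (S n0) s))) (Dir c s)).
      - rewrite (proj2 R s Hs). f_equal. apply functional_extensionality; intro k.
        unfold c, dirac.
        destruct (Nat.eqb_spec k 0) as [->|K0];
          [|destruct (Nat.eqb_spec k n0) as [->|Kn]].
        + destruct n0; [lia|]. simpl. ring.
        + rewrite Nat.leb_refl. ring.
        + destruct (Nat.leb_spec k n0); [rewrite (IH k) by lia|]; ring.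
      - rewrite npow_1. ring. }
    (* With [r = (n0+1)^-x], the two leading terms have modulus at least [1 + r Re be], the
       remainder at most [(n0+2)^-x ||c||]. As [|f| <= 1], division by [r] bounds [Re be] by a
       quantity decaying in [x]. *)
    apply (exp_decay_contradiction (Re be) (l1norm c) (ln (INR (S (S n0))) - ln (INR (S n0))));
      auto.
    { generalize (ln_INR_S_incr n0 (S n0) ltac:(lia)). lra. }
    intros x Hx.
    assert (Hs : 0 < Re (x, t)) by exact Hx.
    assert (F := Hf _ Hs). rewrite (Dec _ Hs) in F.
    assert (T := Cmod_Dir_tail c (S n0) (x, t) Hc ltac:(simpl; lra)
       ltac:(intros j Hj; unfold c; destruct (Nat.leb_spec j n0); [reflexivity|lia])).
    set (r := exp (- (x * ln (INR (S n0))))).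
    assert (E : Cplus (a O) (Cmult (a n0) (npow (S n0) (x, t))) =
      Cmult (a O) (Cplus 1 (Cmult r be))).
    { rewrite npow_cis. fold r. unfold be. field. auto. }
    rewrite E in F.
    assert (G : 1 + r * Re be <= Cmod (Cmult (a O) (Cplus 1 (Cmult r be)))).
    { rewrite Cmod_mult.
      assert (1 + r * Re be <= Cmod (Cplus 1 (Cmult r be))).
      { eapply Rle_trans; [|apply re_le_Cmod]. rewrite re_plus, re_scal_l.
        simpl (Re 1). apply Rle_abs. }
      generalize (Cmod_ge_0 (Cplus 1 (Cmult r be))). nra. }
    assert (Tr := Cmod_triangle (Cplus (Cmult (a O) (Cplus 1 (Cmult r be))) (Dir c (x, t)))
                   (Copp (Dir c (x, t)))).
    rewrite Cmod_opp in Tr.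
    replace (Cplus (Cplus (Cmult (a O) (Cplus 1 (Cmult r be))) (Dir c (x, t)))
                   (Copp (Dir c (x, t)))) with (Cmult (a O) (Cplus 1 (Cmult r be))) in Tr by ring.
    simpl (Re (x, t)) in T.
    assert (M : r * Re be <= exp (- (x * ln (INR (S (S n0))))) * l1norm c) by lra.
    assert (Rr : r * exp (x * ln (INR (S n0))) = 1).
    { unfold r. rewrite <- exp_plus, Rplus_opp_l. apply exp_0. }
    apply (Rmult_le_compat_r (exp (x * ln (INR (S n0))))) in M; [|left; apply exp_pos].
    replace (- (x * (ln (INR (S (S n0))) - ln (INR (S n0))))) with
      (- (x * ln (INR (S (S n0)))) + x * ln (INR (S n0))) by ring.
    rewrite exp_plus. nra. }
  intros s Hs. rewrite (proj2 Haf s Hs), <- (Cmult_1_r (a O)), <- (npow_1 s), <- (Dir_dirac 0 s).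
  rewrite (proj2 (Ap_rep_scal (a O) _ _ (Ap_rep_Dir (dirac 0) (proj1 (l1_dirac 0)))) s Hs).
  f_equal. apply functional_extensionality; intro k. unfold dirac.
  destruct (Nat.eqb_spec k 0) as [->|K]; [ring|]. rewrite Z by lia. ring.
Qed.

(* The coefficients of [f^k] of bounded index tend to zero geometrically, while the others are
   damped by the factor [n^(-Re s)], so [f^k s] tends to zero. *)
Lemma Cmod_lt_1_of_bounded_powers (f : C -> C) (b : nat -> nat -> C) (M x rho : R) :
  (forall k, Ap_rep (b k) (fun s => Cpow (f s) k)) -> (forall k, l1norm (b k) <= M) ->
  0 < x -> 0 <= rho < 1 -> (forall t, Cmod (f (x, t)) <= rho) ->
  forall s, 0 < Re s -> Cmod (f s) < 1.
Proof.
  intros Hb HM Hx Hrho Hf s Hs. apply Rnot_le_lt; intro H1.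
  assert (HM0 : 0 <= M).
  { eapply Rle_trans; [|apply (HM O)]. apply l1norm_nonneg, Hb. }
  assert (P1 : forall k, 1 <= Cmod (f s) ^ k) by (intro; now apply pow_R1_Rle).
  (* [N] makes the part of [f^k] beyond index [N] at most [1/4] at [s], uniformly in [k]. Only then
     is [k] chosen, so that the first [N + 1] terms also add up to at most [1/4]. *)
  destruct (ln_INR_unbounded (4 * M / Re s)) as [N HN].
  specialize (HN (S N) ltac:(lia)).
  set (lam := ln (INR (S (S N)))) in *.
  assert (T1 : exp (- (Re s * lam)) * M <= / 4).
  { assert (4 * M <= Re s * lam).
    { apply (Rmult_le_compat_l (Re s)) in HN; [|lra].
      replace (Re s * (4 * M / Re s)) with (4 * M) in HN by (field; lra). exact HN. }
    assert (Q := exp_ineq1_le (Re s * lam)). assert (P := exp_pos (- (Re s * lam))).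
    assert (E : exp (- (Re s * lam)) * exp (Re s * lam) = 1)
      by (rewrite <- exp_plus, Rplus_opp_l; apply exp_0).
    nra. }
  (* Number of low coefficients times [(N+1)^x], the largest factor lost when Bohr's inequality on
     the line [Re s = x] is freed of its weight. *)
  set (D := INR (S N) * exp (x * ln (INR (S N)))).
  assert (PD : 0 < D).
  { apply Rmult_lt_0_compat; [apply lt_0_INR; lia | apply exp_pos]. }
  destruct (pow_lt_1_zero rho ltac:(rewrite Rabs_pos_eq; lra) (/ (4 * D))) as [k Hk].
  { apply Rinv_0_lt_compat; lra. }
  specialize (Hk k ltac:(lia)).
  assert (Pk : 0 <= rho ^ k) by (apply pow_le; lra).
  rewrite Rabs_pos_eq in Hk by auto.
  assert (T2 : rho ^ k * D <= / 4).
  { apply Rlt_le in Hk. apply (Rmult_le_compat_r D) in Hk; [|lra].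
    replace (/ (4 * D) * D) with (/ 4) in Hk by (field; lra). exact Hk. }
  destruct (Hb k) as [Hl Hr]. specialize (P1 k).
  rewrite <- Cmod_pow, (Hr s Hs) in P1.
  destruct (l1_dterm (b k) s Hl ltac:(lra)) as [Hd _].
  destruct (CSeries_csum_tail _ (S N) Hd) as [Ht E]. unfold Dir in P1. rewrite E in P1.
  assert (B1 : Cmod (csum (dterm (b k) s) (S N)) <= rho ^ k * D).
  { replace (rho ^ k * D) with (sum_f_R0 (fun _ => rho ^ k * exp (x * ln (INR (S N)))) N)
      by (rewrite sum_cte; unfold D; ring).
    apply Cmod_csum. intros m Hm.
    apply Rle_trans with (1 := Cmod_dterm_le (b k) s m ltac:(lra)).
    assert (CB : Cmod (b k m) * exp (- (x * ln (INR (S m)))) <= rho ^ k).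
    { apply coef_bound_line; auto; [lra|]. intro t. rewrite <- Hr by exact Hx.
      rewrite Cmod_pow. apply pow_incr. split; [apply Cmod_ge_0 | apply Hf]. }
    apply (Rmult_le_compat_r (exp (x * ln (INR (S m))))) in CB; [|left; apply exp_pos].
    rewrite Rmult_assoc, <- exp_plus, Rplus_opp_l, exp_0, Rmult_1_r in CB.
    eapply Rle_trans; [exact CB|]. apply Rmult_le_compat_l; auto.
    apply exp_le_compat, Rmult_le_compat_l; [lra|].
    apply ln_le; [apply lt_0_INR; lia | apply le_INR; lia]. }
  assert (B2 : Cmod (CSeries (fun j => dterm (b k) s (S N + j)%nat)) <= exp (- (Re s * lam)) * M).
  { eapply Rle_trans; [now apply Cmod_CSeries|].
    assert (U : forall j, Cmod (dterm (b k) s (S N + j)%nat) <=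
      exp (- (Re s * lam)) * Cmod (b k (S N + j)%nat)).
    { intro j. unfold dterm. rewrite Cmod_mult, Rmult_comm.
      apply Rmult_le_compat_r; [apply Cmod_ge_0|]. rewrite Cmod_npow.
      apply exp_le_compat, Ropp_le_contravar, Rmult_le_compat_l; [lra|].
      apply ln_le; [apply lt_0_INR; lia | apply le_INR; lia]. }
    destruct (CSeries_csum_tail (b k) (S N) Hl) as [Hlt _].
    eapply Rle_trans; [apply l1_le; [exact U | now apply ex_series_scal_R]|].
    rewrite Series_scal_l. apply Rmult_le_compat_l; [left; apply exp_pos|].
    eapply Rle_trans; [|apply (HM k)].
    unfold l1norm. rewrite (Series_incr_n (fun k0 => Cmod (b k k0)) (S N)) by (auto; lia).
    assert (0 <= sum_f_R0 (fun k0 => Cmod (b k k0)) (pred (S N)))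
      by (apply cond_pos_sum; intro; apply Cmod_ge_0).
    lra. }
  assert (Tr := Cmod_triangle (csum (dterm (b k) s) (S N))
    (CSeries (fun j => dterm (b k) s (S N + j)%nat))).
  lra.
Qed.

(** At [s0] the function [q^-phi] has modulus 1. If its constant coefficient were smaller than 1 in
    modulus, its powers [(q^k)^-phi], bounded by [M], would force modulus below 1 everywhere. *)
Lemma npow_const_of_boundary_point (phi : C -> C) (B : nat -> nat -> C) (M : R) (q : nat) (s0 : C) :
  (2 <= q)%nat ->
  (forall n, Ap_rep (B n) (npow_phi phi (S n))) -> (forall n, l1norm (B n) <= M) ->
  (forall s, 0 < Re s -> 0 <= Re (phi s)) -> 0 < Re s0 -> Re (phi s0) = 0 ->
  forall s s', 0 < Re s -> 0 < Re s' -> npow q (phi s) = npow q (phi s').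
Proof.
  intros Hq HB HM Hre Hs0 E0 s s' Hs Hs'.
  destruct q as [|q]; [lia|].
  assert (Hf : forall w, 0 < Re w -> Cmod (npow (S q) (phi w)) <= 1)
    by (intros; apply Cmod_npow_le_1; auto).
  destruct (Rle_lt_dec 1 (Cmod (B q O))) as [H1|H1].
  - transitivity (B q O); [|symmetry].
    + exact (Ap_rep_const _ _ (HB q) Hf H1 s Hs).
    + exact (Ap_rep_const _ _ (HB q) Hf H1 s' Hs').
  - exfalso.
    set (c := fun k => if Nat.eqb k 0 then RtoC 0 else B q k).
    assert (Hc : l1 c).
    { apply (l1_le _ _) with (2 := proj1 (HB q)). intro k. unfold c.
      destruct (Nat.eqb k 0); [rewrite Cmod_0; apply Cmod_ge_0 | lra]. }
    assert (Dec : forall w, 0 < Re w -> npow (S q) (phi w) = Cplus (B q O) (Dir c w)).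
    { intros w Hw.
      assert (R := Ap_rep_plus _ _ _ _ (Ap_rep_scal (B q O) _ _ (Ap_rep_npow 0))
        (Ap_rep_Dir c Hc)).
      change (npow (S q) (phi w)) with (npow_phi phi (S q) w).
      rewrite (proj2 (HB q) w Hw).
      transitivity (Cplus (Cmult (B q O) (npow 1 w)) (Dir c w)).
      - rewrite (proj2 R w Hw). f_equal. apply functional_extensionality; intro k.
        unfold c, dirac. destruct (Nat.eqb_spec k 0) as [->|]; ring.
      - rewrite npow_1. ring. }
    (* Half of the gap to 1: on a line where the nonconstant part is below [d], the bound
       [rho = |B q 0| + d] is still less than 1. *)
    set (d := (1 - Cmod (B q O)) / 2).
    assert (X : exists x, 0 < x /\ l1norm c * exp (- (x * ln (INR 2))) < d).
    { apply NNPP; intro Hn.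
      apply (exp_decay_contradiction d (l1norm c) (ln (INR 2))).
      - unfold d; lra.
      - rewrite <- ln_1. apply ln_increasing; simpl; lra.
      - intros x Hx. apply Rnot_lt_le. intro L. apply Hn. now exists x. }
    destruct X as [x [Hx Xd]].
    assert (L1 : Cmod (npow (S q) (phi s0)) < 1).
    { apply (Cmod_lt_1_of_bounded_powers (fun w => npow (S q) (phi w))
        (fun k => B (pred (S q ^ k))) M x (Cmod (B q O) + d)); auto.
      - intro k. apply Ap_rep_ext with (2 := HB _). intros w Hw. unfold npow_phi.
        rewrite <- npow_pow by lia. f_equal.
        assert (S q ^ k <> 0)%nat by (apply Nat.pow_nonzero; lia). lia.
      - unfold d. generalize (Cmod_ge_0 (B q O)). lra.
      - intro t. rewrite Dec by exact Hx.
        eapply Rle_trans; [apply Cmod_triangle|]. apply Rplus_le_compat_l.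
        apply Rlt_le. apply Rle_lt_trans with (2 := Xd). rewrite Rmult_comm.
        apply (Cmod_Dir_tail c 1 (x, t)); [auto | simpl; lra|].
        intros j Hj. unfold c. destruct j; [reflexivity|lia]. }
    rewrite Cmod_npow, E0, Rmult_0_l, Ropp_0, exp_0 in L1. lra.
Qed.

Lemma cos_eq_1 (x : R) : cos x = 1 -> exists k : Z, x = IZR k * (2 * PI).
Proof.
  intro H. destruct (sin_eq_0_0 (x / 2)) as [k Hk].
  - replace x with (2 * (x / 2)) in H by field. rewrite cos_2a_sin in H. nra.
  - exists k. lra.
Qed.

Lemma cexp_eq (z w : C) : cexp z = cexp w ->
  Re z = Re w /\ exists k : Z, Im z - Im w = IZR k * (2 * PI).
Proof.
  intro H.
  assert (E : Re z = Re w).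
  { apply exp_inv. rewrite <- !Cmod_cexp. now rewrite H. }
  split; auto. apply cos_eq_1.
  assert (D : cexp (Cplus z (Copp w)) = 1).
  { rewrite cexp_plus, H, <- cexp_plus, Cplus_opp_r. apply cexp_0. }
  apply (f_equal Re) in D. simpl in D.
  replace (fst z + - fst w) with 0 in D by (unfold Re in E; lra).
  rewrite exp_0, Rmult_1_l in D. exact D.
Qed.

Lemma pow_3_neq_pow_2 (a b : nat) : (3 ^ a = 2 ^ b)%nat -> b = O.
Proof.
  intro H. destruct b; auto. exfalso.
  assert (O1 : Nat.odd (3 ^ a) = true)
    by (clear; induction a; [reflexivity|]; rewrite Nat.pow_succ_r', Nat.odd_mul, IHa; reflexivity).
  rewrite H, Nat.pow_succ_r', Nat.odd_mul in O1. discriminate.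
Qed.

(** Taking absolute values and exponentials yields [3^|j| = 2^|k|], which parity excludes unless
    [k = 0]. *)
Lemma ln_2_ln_3_independent (j k : Z) : IZR j * ln 3 = IZR k * ln 2 -> k = 0%Z.
Proof.
  intro H.
  assert (P2 : 0 < ln 2) by (rewrite <- ln_1; apply ln_increasing; lra).
  assert (P3 : 0 < ln 3) by (rewrite <- ln_1; apply ln_increasing; lra).
  assert (A : INR (Z.abs_nat j) * ln 3 = INR (Z.abs_nat k) * ln 2).
  { rewrite !INR_IZR_INZ, !Zabs2Nat.id_abs, !abs_IZR.
    rewrite <- (Rabs_pos_eq (ln 3)), <- (Rabs_pos_eq (ln 2)) by lra.
    rewrite <- !Rabs_mult. now rewrite H. }
  rewrite <- !ln_pow in A by lra. apply ln_inv in A; try (apply pow_lt; lra).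
  assert (N : (3 ^ Z.abs_nat j = 2 ^ Z.abs_nat k)%nat).
  { apply INR_eq. rewrite !pow_INR. simpl INR. replace (1 + 1 + 1) with 3 by ring.
    replace (1 + 1) with 2 by ring. exact A. }
  apply pow_3_neq_pow_2 in N. lia.
Qed.

(** Base 2 fixes the real part and puts [Im z - Im w] in the multiples of [2 pi / ln 2]; base 3 puts
    it in those of [2 pi / ln 3]. The two lattices meet only at 0. *)
Lemma npow_2_3_injective (z w : C) : npow 2 z = npow 2 w -> npow 3 z = npow 3 w -> z = w.
Proof.
  intros H2 H3. unfold npow in *.
  replace (INR 2) with 2 in H2 by (simpl; ring). replace (INR 3) with 3 in H3 by (simpl; ring).
  assert (P2 : 0 < ln 2) by (rewrite <- ln_1; apply ln_increasing; lra).
  assert (P3 : 0 < ln 3) by (rewrite <- ln_1; apply ln_increasing; lra).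
  apply cexp_eq in H2. apply cexp_eq in H3.
  destruct H2 as [R2 [j Hj]]. destruct H3 as [_ [k Hk]].
  rewrite !re_opp, !re_scal_r in R2. rewrite !im_opp, !im_scal_r in Hj, Hk.
  assert (PP := PI_RGT_0).
  assert (K : IZR j * ln 3 = IZR k * ln 2).
  { apply (Rmult_eq_reg_r (2 * PI)); [|lra].
    replace (IZR j * ln 3 * (2 * PI)) with (IZR j * (2 * PI) * ln 3) by ring.
    replace (IZR k * ln 2 * (2 * PI)) with (IZR k * (2 * PI) * ln 2) by ring.
    rewrite <- Hj, <- Hk. ring. }
  apply ln_2_ln_3_independent in K. subst k. apply C_ext; [nra|].
  rewrite Rmult_0_l in Hk. nra.
Qed.

Lemma symbol_Re_pos (phi : C -> C) (B : nat -> nat -> C) (M : R) :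
  (exists s1 s2, 0 < Re s1 /\ 0 < Re s2 /\ phi s1 <> phi s2) ->
  (forall n, Ap_rep (B n) (npow_phi phi (S n))) -> (forall n, l1norm (B n) <= M) ->
  forall s, 0 < Re s -> 0 < Re (phi s).
Proof.
  intros (s1 & s2 & Hs1 & Hs2 & Hne) HB HM.
  (* If [Re (phi s) < 0], then [|n^-phi(s)|] tends to infinity with [n], against the bound [M]. *)
  assert (Hre : forall s, 0 < Re s -> 0 <= Re (phi s)).
  { intros s Hs. apply Rnot_lt_le; intro L.
    destruct (ln_INR_unbounded (M / - Re (phi s))) as [n Hn]. specialize (Hn n ltac:(lia)).
    assert (H := Cmod_Ap_rep _ _ s (HB n) Hs). unfold npow_phi in H. rewrite Cmod_npow in H.
    specialize (HM n). assert (Q := exp_ineq1_le (- (Re (phi s) * ln (INR (S n))))).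
    apply (Rmult_le_compat_l (- Re (phi s))) in Hn; [|lra].
    replace (- Re (phi s) * (M / - Re (phi s))) with M in Hn by (field; lra).
    lra. }
  intros s Hs. destruct (Hre s Hs) as [|E]; auto. exfalso. apply Hne.
  apply npow_2_3_injective.
  - apply (npow_const_of_boundary_point phi B M 2 s); auto.
  - apply (npow_const_of_boundary_point phi B M 3 s); auto.
Qed.

(** * Compactness *)

Lemma cluster_point (v : nat -> R) (K : R) : (forall j, Rabs (v j) <= K) ->
  exists x, forall eps J, 0 < eps -> exists j, (J <= j)%nat /\ Rabs (v j - x) < eps.
Proof.
  intro H.
  destruct (Bolzano_Weierstrass v (fun x => - K <= x <= K)) as [x Hx].
  - apply compact_P3.
  - intro n. specialize (H n). now apply Rabs_le_between in H.
  - exists x. intros eps J He. destruct (Hx (disc x (mkposreal eps He)) J) as [p [Hp1 Hp2]].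
    + exists (mkposreal eps He). intros y Hy; exact Hy.
    + exists p. split; [lia | exact Hp2].
Qed.

Definition near_upto (u : nat -> nat -> R) (N : nat) (l : nat -> R) (eps : R) (j : nat) : Prop :=
  forall i, (i < N)%nat -> Rabs (u i j - l i) < eps.

Lemma inv_INR_S_small (eps : R) : 0 < eps ->
  exists N, forall n, (N <= n)%nat -> / INR (S n) < eps.
Proof.
  intro He. destruct (nfloor_ex (/ eps)) as [N [_ HN]]; [left; now apply Rinv_0_lt_compat|].
  exists N. intros n Hn. apply le_INR in Hn.
  rewrite <- (Rinv_inv eps). apply Rinv_lt_contravar.
  - apply Rmult_lt_0_compat; [now apply Rinv_0_lt_compat | apply lt_0_INR; lia].
  - rewrite S_INR. lra.
Qed.

(* The coordinates of the limit are chosen one after the other, keeping infinitely many indices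
   close to all coordinates chosen so far. *)
Lemma diagonal_extraction (u : nat -> nat -> R) (K : R) :
  (forall i j, Rabs (u i j) <= K) ->
  exists (sigma : nat -> nat) (l : nat -> R),
    (forall j, (sigma j < sigma (S j))%nat) /\
    forall i, is_lim_seq (fun j => u i (sigma j)) (l i).
Proof.
  intro Hu.
  set (good := fun N l => forall eps J, 0 < eps -> exists j, (J <= j)%nat /\ near_upto u N l eps j).
  assert (Hstep : forall Nl : nat * (nat -> R), exists x, good (fst Nl) (snd Nl) ->
    good (S (fst Nl)) (fun i => if Nat.eqb i (fst Nl) then x else snd Nl i)).
  { intros [N l]. simpl. destruct (classic (good N l)) as [G|G]; [|exists 0; tauto].
    assert (T : forall k, exists j, (k <= j)%nat /\ near_upto u N l (/ INR (S k)) j).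
    { intro k. apply G. apply Rinv_0_lt_compat, lt_0_INR. lia. }
    destruct (choice_fun _ T) as [js Hjs].
    destruct (cluster_point (fun k => u N (js k)) K) as [x Hx]; [intro; apply Hu|].
    exists x. intros _ eps J He.
    destruct (inv_INR_S_small eps He) as [N1 HN1].
    destruct (Hx eps (J + N1)%nat He) as [k [Hk1 Hk2]].
    destruct (Hjs k) as [E1 E2].
    exists (js k). split; [lia|]. intros i Hi.
    destruct (Nat.eqb_spec i N) as [->|]; [exact Hk2|].
    eapply Rlt_trans; [apply E2; lia | apply HN1; lia]. }
  destruct (choice_fun _ Hstep) as [F HF].
  set (L := fix L N : nat -> R := match N with
    | O => fun _ => 0
    | S N' => fun i => if Nat.eqb i N' then F (N', L N') else L N' i end).
  assert (HL : forall N, good N (L N)).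
  { induction N.
    - intros eps J _. exists J. split; [lia|]. intros i Hi. lia.
    - exact (HF (N, L N) IHN). }
  (* Coordinate [i] is fixed at stage [i + 1] and never changed later, so the diagonal collects all
     the choices. *)
  set (l := fun i => L (S i) i).
  assert (El : forall N i, (i < N)%nat -> L N i = l i).
  { induction N; intros i Hi; [lia|].
    destruct (Nat.eq_dec i N) as [->|Hne]; [reflexivity|].
    rewrite <- IHN by lia. cbn. destruct (Nat.eqb_spec i N); [lia|reflexivity]. }
  assert (T : forall kJ : nat * nat, exists j, (snd kJ <= j)%nat /\
    near_upto u (S (fst kJ)) l (/ INR (S (fst kJ))) j).
  { intros [k J]. simpl fst; simpl snd.
    destruct (HL (S k) (/ INR (S k)) J) as [j [Hj1 Hj2]].
    - apply Rinv_0_lt_compat, lt_0_INR. lia.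
    - exists j. split; auto. intros i Hi. rewrite <- (El (S k) i Hi). auto. }
  destruct (choice_fun _ T) as [G HG].
  set (sigma := fix sg k := match k with O => G (O, O) | S k' => G (S k', S (sg k')) end).
  assert (Hs : forall k, near_upto u (S k) l (/ INR (S k)) (sigma k)).
  { intro k. destruct k; [apply (HG (O, O)) | apply (HG (S k, S (sigma k)))]. }
  exists sigma, l. split.
  - intro j. exact (proj1 (HG (S j, S (sigma j)))).
  - intro i. apply is_lim_seq_spec. intro eps.
    destruct (inv_INR_S_small eps (cond_pos eps)) as [N HN].
    exists (N + i)%nat. intros n Hn.
    eapply Rlt_trans; [apply (Hs n); lia | apply HN; lia].
Qed.

Lemma is_lim_seq_Cmod (z : nat -> C) (w : C) :
  is_lim_seq (fun j => Re (z j)) (Re w) -> is_lim_seq (fun j => Im (z j)) (Im w) ->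
  is_lim_seq (fun j => Cmod (Cminus (z j) w)) 0.
Proof.
  intros H1 H2.
  apply (is_lim_seq_le_le (fun _ => 0) _ (fun j => Rabs (Re (z j) - Re w) + Rabs (Im (z j) - Im w))).
  - intro j. split; [apply Cmod_ge_0|].
    replace (Cminus (z j) w) with
      (Cplus (RtoC (Re (z j) - Re w)) (Cmult (RtoC (Im (z j) - Im w)) Ci)).
    + eapply Rle_trans; [apply Cmod_triangle|].
      rewrite Cmod_mult, !Cmod_R, Cmod_Ci. lra.
    + apply C_ext; simpl; unfold Re, Im; ring.
  - apply is_lim_seq_const.
  - assert (A : forall (f : nat -> R) (x : R), is_lim_seq f x -> is_lim_seq (fun j => Rabs (f j - x)) 0).
    { intros f x H. apply is_lim_seq_spec. apply is_lim_seq_spec in H. intro eps.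
      destruct (H eps) as [N HN]. exists N. intros n Hn.
      rewrite Rminus_0_r, Rabs_Rabsolu. auto. }
    replace (Finite 0) with (Finite (0 + 0)) by (f_equal; ring).
    apply is_lim_seq_plus'; auto.
Qed.

(** Weak-star sequential compactness of balls of l^1, as the dual of c_0. Real and imaginary parts
    are interleaved at even and odd indices for the diagonal extraction; the bound on the limit
    follows from its partial sums, as in Fatou's lemma. *)
Lemma l1_bounded_extraction (A : nat -> nat -> C) (K : R) :
  (forall j, l1 (A j)) -> (forall j, l1norm (A j) <= K) ->
  exists (sigma : nat -> nat) (al : nat -> C),
    (forall j, (sigma j < sigma (S j))%nat) /\ l1 al /\ l1norm al <= K /\
    forall n, is_lim_seq (fun j => Cmod (Cminus (A (sigma j) n) (al n))) 0.
Proof.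
  intros HA HK.
  assert (HC : forall j n, Cmod (A j n) <= K).
  { intros j n. eapply Rle_trans; [now apply Cmod_le_l1norm | apply HK]. }
  destruct (diagonal_extraction (fun i j =>
    if Nat.even i then Re (A j (Nat.div2 i)) else Im (A j (Nat.div2 i))) K)
    as (sigma & l & Hs & Hl).
  { intros i j. destruct (Nat.even i).
    - eapply Rle_trans; [apply re_le_Cmod | apply HC].
    - eapply Rle_trans; [apply im_le_Cmod | apply HC]. }
  set (al := fun n => (l (2 * n)%nat, l (S (2 * n))) : C).
  assert (Hlim : forall n, is_lim_seq (fun j => Cmod (Cminus (A (sigma j) n) (al n))) 0).
  { intro n. apply is_lim_seq_Cmod.
    - specialize (Hl (2 * n)%nat). rewrite Nat.even_even, Nat.div2_double in Hl. exact Hl.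
    - specialize (Hl (S (2 * n))).
      rewrite Nat.div2_succ_double in Hl. rewrite <- Nat.add_1_r, Nat.even_odd in Hl.
      rewrite Nat.add_1_r in Hl. exact Hl. }
  assert (X : forall N, sum_f_R0 (fun n => Cmod (al n)) N <= K).
  { intro N.
    assert (S1 : is_lim_seq (fun j => sum_f_R0 (fun n => Cmod (Cminus (A (sigma j) n) (al n))) N + K)
                          (0 + K)).
    { apply is_lim_seq_plus'; [|apply is_lim_seq_const].
      induction N; [apply Hlim|]. cbn [sum_f_R0].
      replace (Finite 0) with (Finite (0 + 0)) by (f_equal; ring).
      now apply is_lim_seq_plus'. }
    rewrite Rplus_0_l in S1.
    apply (is_lim_seq_le (fun _ => sum_f_R0 (fun n => Cmod (al n)) N) _
      (sum_f_R0 (fun n => Cmod (al n)) N) K) with (2 := is_lim_seq_const _) (3 := S1).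
    intro j. rewrite Rplus_comm.
    apply Rle_trans with (sum_f_R0 (fun n => Cmod (A (sigma j) n)) N +
      sum_f_R0 (fun n => Cmod (Cminus (A (sigma j) n) (al n))) N).
    - rewrite <- sum_plus. apply sum_Rle. intros n _.
      replace (al n) with (Cplus (A (sigma j) n) (Copp (Cminus (A (sigma j) n) (al n)))) at 1 by ring.
      rewrite <- (Cmod_opp (Cminus _ _)). apply Cmod_triangle.
    - apply Rplus_le_compat_r. eapply Rle_trans; [|apply (HK (sigma j))].
      apply (sum_le_Series (fun n => Cmod (A (sigma j) n))); [intro; apply Cmod_ge_0 | apply HA]. }
  destruct (Series_nonneg_bound (fun n => Cmod (al n)) K) as [L1 L2]; auto.
  { intro; apply Cmod_ge_0. }
  exists sigma, al. auto.
Qed.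

(** [f o phi] is the superposition of the [n^-phi] with the coefficients of [f]. The weighted bound
    is kept beside [M * l1norm a], since only the former sees a decay of [l1norm (B n)]. *)
Lemma Ap_rep_Ccomp (phi : C -> C) (B : nat -> nat -> C) (M : R) (a : nat -> C) :
  (forall n, Ap_rep (B n) (npow_phi phi (S n))) -> (forall n, l1norm (B n) <= M) -> l1 a ->
  ex_series (fun n => Cmod (a n) * l1norm (B n)) /\
  Ap_rep (superp a B) (Ccomp phi a) /\
  l1norm (superp a B) <= Series (fun n => Cmod (a n) * l1norm (B n)) /\
  l1norm (superp a B) <= M * l1norm a.
Proof.
  intros HB HM Ha.
  assert (D : forall n, 0 <= Cmod (a n) * l1norm (B n) <= M * Cmod (a n)).
  { intro n. generalize (HM n) (l1norm_nonneg _ (proj1 (HB n))) (Cmod_ge_0 (a n)).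
    split; nra. }
  assert (E : ex_series (fun n => M * Cmod (a n))) by now apply ex_series_scal_R.
  assert (X : ex_series (fun n => Cmod (a n) * l1norm (B n))).
  { apply ex_series_le_R with (2 := E). intro n. rewrite Rabs_pos_eq; apply D. }
  destruct (Ap_rep_superp a B (fun n => npow_phi phi (S n)) HB X) as [P Q].
  split; [exact X | split; [exact P | split; [exact Q|]]].
  eapply Rle_trans; [exact Q|]. unfold l1norm at 2. rewrite <- Series_scal_l.
  now apply Series_le.
Qed.

Lemma npow_phi_reps (phi : C -> C) :
  (forall n, (1 <= n)%nat -> inAp (npow_phi phi n)) ->
  exists B : nat -> nat -> C, forall n, Ap_rep (B n) (npow_phi phi (S n)).
Proof.
  intro H. apply (choice_fun (fun n a => Ap_rep a (npow_phi phi (S n)))).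
  intro n. apply H. lia.
Qed.

Lemma comp_bounded_of_npow (phi : C -> C) (B : nat -> nat -> C) (M : R) :
  (exists s1 s2, 0 < Re s1 /\ 0 < Re s2 /\ phi s1 <> phi s2) ->
  (forall n, Ap_rep (B n) (npow_phi phi (S n))) -> (forall n, l1norm (B n) <= M) ->
  comp_bounded phi.
Proof.
  intros Hne HB HM.
  assert (Hpos := symbol_Re_pos phi B M Hne HB HM).
  split; [split|].
  - intros s Hs. left; auto.
  - intros a Ha. exists (superp a B). now apply (Ap_rep_Ccomp phi B M).
  - exists M. intros a Ha. destruct (Ap_rep_Ccomp phi B M a HB HM Ha) as (_ & R & _ & Q).
    now rewrite (Apnorm_rep _ _ R).
Qed.

(* A coordinatewise convergent subsequence suffices, since [n^-phi] is small for large [n]. *)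
Lemma comp_compact_of_decay (phi : C -> C) (B : nat -> nat -> C) (M : R) :
  (exists s1 s2, 0 < Re s1 /\ 0 < Re s2 /\ phi s1 <> phi s2) ->
  (forall n, Ap_rep (B n) (npow_phi phi (S n))) -> (forall n, l1norm (B n) <= M) ->
  is_lim_seq (fun n => l1norm (B n)) 0 -> comp_compact phi.
Proof.
  intros Hne HB HM Hlim.
  assert (Hpos := symbol_Re_pos phi B M Hne HB HM).
  split; [apply (comp_bounded_of_npow phi B M Hne HB HM)|].
  intros A HA [K HK].
  destruct (l1_bounded_extraction A K HA HK) as (sigma & al & Hs & Hal & HalK & Hc).
  exists sigma, (superp al B). split; [exact Hs|].
  destruct (Ap_rep_Ccomp phi B M al HB HM Hal) as (_ & Ral & _ & _).
  split; [apply Ral|].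
  set (D := fun j n => Cplus (A (sigma j) n) (Cmult (-1)%R (al n))).
  assert (Dabs : forall j n, Cmod (D j n) = Cmod (Cminus (A (sigma j) n) (al n))).
  { intros j n. unfold D. f_equal. ring. }
  assert (HD : forall j, l1 (D j) /\ l1norm (D j) <= 2 * K).
  { intro j. destruct (l1_scal (-1)%R al Hal) as [S1 S2].
    destruct (l1_plus _ _ (HA (sigma j)) S1) as [P1 P2]. split; [exact P1|].
    eapply Rle_trans; [exact P2|]. rewrite S2, Cmod_R, Rabs_left by lra.
    specialize (HK (sigma j)). lra. }
  set (w := fun j n => Cmod (D j n) * l1norm (B n)).
  assert (HB0 : forall n, 0 <= l1norm (B n)) by (intro; apply l1norm_nonneg, HB).
  assert (HN : forall j, ex_series (w j) /\
    0 <= Apnorm (fun s => Cminus (Ccomp phi (A (sigma j)) s) (Dir (superp al B) s)) <= Series (w j)).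
  { intro j. destruct (Ap_rep_Ccomp phi B M (D j) HB HM (proj1 (HD j))) as (X & R & Q & _).
    split; [exact X|].
    assert (R' : Ap_rep (superp (D j) B)
      (fun s => Cminus (Ccomp phi (A (sigma j)) s) (Dir (superp al B) s))).
    { apply Ap_rep_ext with (2 := R). intros s Hs0.
      rewrite <- (proj2 Ral s Hs0). unfold Ccomp, D.
      destruct (l1_scal (-1)%R al Hal) as [S1 _].
      rewrite Dir_plus by auto. unfold Cminus. f_equal.
      transitivity (Cmult (-1)%R (Dir al (phi s))).
      - symmetry. exact (proj2 (Ap_rep_scal (-1)%R _ _ (Ap_rep_Dir al Hal)) (phi s) (Hpos s Hs0)).
      - ring. }
    rewrite (Apnorm_rep _ _ R'). split; [apply l1norm_nonneg, R' | exact Q]. }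
  apply is_lim_seq_spec. intro eps.
  assert (K0 : 0 <= K).
  { eapply Rle_trans; [|apply (HK O)]. now apply l1norm_nonneg. }
  (* [2 K] bounds the norm of the differences [D j], so indices with [l1norm (B n) < e] contribute
     less than [eps / 2]; the [+ 1] keeps the denominator positive when [K = 0]. *)
  set (e := eps / (2 * (2 * K + 1))).
  assert (He : 0 < e) by (unfold e; apply Rdiv_lt_0_compat; [apply cond_pos | lra]).
  apply is_lim_seq_spec in Hlim. destruct (Hlim (mkposreal e He)) as [N HNe]. simpl in HNe.
  assert (Hfin : is_lim_seq (fun j => sum_f_R0 (w j) N) 0).
  { assert (W : forall n, is_lim_seq (fun j => w j n) 0).
    { intro n. unfold w. replace (Finite 0) with (Finite (0 * l1norm (B n))) by (f_equal; ring).
      apply is_lim_seq_mult'; [|apply is_lim_seq_const].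
      apply is_lim_seq_ext with (2 := Hc n). intro; now rewrite Dabs. }
    clear HNe. induction N; [apply W|]. cbn [sum_f_R0].
    replace (Finite 0) with (Finite (0 + 0)) by (f_equal; ring).
    apply is_lim_seq_plus'; auto. }
  apply is_lim_seq_spec in Hfin.
  destruct (Hfin (mkposreal (eps / 2) ltac:(generalize (cond_pos eps); lra))) as [J HJ].
  simpl in HJ. exists J. intros j Hj. specialize (HJ j Hj).
  destruct (HN j) as [X [Y1 Y2]].
  rewrite Rminus_0_r, Rabs_pos_eq by auto.
  apply Rle_lt_trans with (1 := Y2).
  rewrite (Series_incr_n _ (S N)) by (auto; lia). simpl pred.
  assert (T : Series (fun k => w j (S N + k)%nat) <= e * (2 * K)).
  { destruct (CSeries_csum_tail (D j) (S N) (proj1 (HD j))) as [Tl _].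
    apply Rle_trans with (Series (fun k => e * Cmod (D j (S N + k)%nat))).
    - apply Series_le; [|now apply ex_series_scal_R].
      intro k. unfold w. split; [apply Rmult_le_pos; auto; apply Cmod_ge_0|].
      rewrite Rmult_comm. apply Rmult_le_compat_r; [apply Cmod_ge_0|].
      specialize (HNe (S N + k)%nat ltac:(lia)). rewrite Rminus_0_r, Rabs_pos_eq in HNe by auto. lra.
    - rewrite Series_scal_l. apply Rmult_le_compat_l; [lra|].
      eapply Rle_trans; [|apply (HD j)]. unfold l1norm.
      rewrite (Series_incr_n (fun k => Cmod (D j k)) (S N)); [|lia | apply HD].
      assert (0 <= sum_f_R0 (fun k => Cmod (D j k)) (pred (S N)))
        by (apply cond_pos_sum; intro; apply Cmod_ge_0).
      lra. }
  assert (E2 : e * (2 * K + 1) = eps / 2) by (unfold e; field; lra).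
  rewrite Rminus_0_r in HJ. apply Rabs_def2 in HJ. lra.
Qed.

(** If decay fails, compactness is tested on monomials [n^-s] whose images keep norm at least [eps].
    Since [Re phi > 0], these images tend to 0 at every point, so the limit in norm of a subsequence
    can only be 0, a contradiction. Conversely, a sequence of norms tending to 0 is bounded and
    decays, which gives compactness. *)
Lemma comp_compact_iff_decay (phi : C -> C) :
  (exists s1 s2, 0 < Re s1 /\ 0 < Re s2 /\ phi s1 <> phi s2) ->
  (comp_compact phi <->
    (forall n, (1 <= n)%nat -> inAp (npow_phi phi n)) /\
    is_lim_seq (fun n => Apnorm (npow_phi phi n)) 0).
Proof.
  intro Hne. split.
  - intros [Hmaps Hcpt].
    destruct (comp_maps_npow_bounded phi Hmaps) as [Hin [K [_ HK]]]. split; auto.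
    destruct (npow_phi_reps phi Hin) as [B HB].
    assert (HBK : forall n, l1norm (B n) <= K).
    { intro n. rewrite <- (Apnorm_rep _ _ (HB n)). apply HK. lia. }
    assert (Hpos := symbol_Re_pos phi B K Hne HB HBK).
    (* Discards the index [n = 0], where [n^-phi] has no meaning. *)
    apply (is_lim_seq_incr_1 (fun n => Apnorm (npow_phi phi n))).
    apply is_lim_seq_spec. intro eps. apply NNPP; intro Hno.
    assert (T : forall j, exists n, (j <= n)%nat /\ eps <= l1norm (B n)).
    { intro j. apply NNPP; intro Hn. apply Hno. exists j. intros n Hjn.
      rewrite Rminus_0_r, (Apnorm_rep _ _ (HB n)), Rabs_pos_eq by apply l1norm_nonneg, HB.
      apply Rnot_le_lt. intro L. apply Hn. now exists n. }
    destruct (choice_fun _ T) as [h Hh].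
    destruct (Hcpt (fun j => dirac (h j))) as (sigma & b & Hs & Hb & Hlim).
    { intro j; apply l1_dirac. }
    { exists 1. intro j. right; apply l1_dirac. }
    assert (Hsj : forall j, (j <= sigma j)%nat).
    { induction j; [lia|]. specialize (Hs j). lia. }
    set (g := fun j s => Cminus (Ccomp phi (dirac (h (sigma j))) s) (Dir b s)).
    assert (Hg : forall j, Ap_rep (fun k => Cminus (B (h (sigma j)) k) (b k)) (g j)).
    { intro j. apply Ap_rep_minus; [|now apply Ap_rep_Dir].
      apply Ap_rep_ext with (2 := HB (h (sigma j))). intros s Hs0.
      unfold Ccomp. now rewrite Dir_dirac. }
    assert (Hb0 : forall s, 0 < Re s -> Dir b s = 0).
    { intros s Hs0. apply Cmod_eq_0. apply Rle_antisym; [|apply Cmod_ge_0].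
      apply le_epsilon. intros d Hd. rewrite Rplus_0_l.
      apply is_lim_seq_spec in Hlim.
      destruct (Hlim (mkposreal (d / 2) ltac:(lra))) as [J HJ]. simpl in HJ.
      specialize (Hpos s Hs0).
      destruct (ln_INR_unbounded (- ln (d / 2) / Re (phi s))) as [N HN].
      set (j := (J + N)%nat). specialize (HJ j ltac:(unfold j; lia)).
      assert (C1 := Cmod_Ap_rep _ _ s (Hg j) Hs0).
      rewrite <- (Apnorm_rep _ _ (Hg j)) in C1.
      rewrite Rminus_0_r in HJ. apply Rabs_def2 in HJ.
      assert (C2 : Cmod (npow (S (h (sigma j))) (phi s)) <= d / 2).
      { rewrite Cmod_npow. rewrite <- (exp_ln (d / 2)) by lra. apply exp_le_compat.
        specialize (HN (h (sigma j))).
        assert (N <= h (sigma j))%nat.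
        { specialize (Hsj j). generalize (proj1 (Hh (sigma j))). unfold j in *. lia. }
        specialize (HN H). apply (Rmult_le_compat_l (Re (phi s))) in HN; [|lra].
        replace (Re (phi s) * (- ln (d / 2) / Re (phi s))) with (- ln (d / 2)) in HN
          by (field; lra). lra. }
      replace (Dir b s) with (Cplus (npow (S (h (sigma j))) (phi s)) (Copp (g j s))).
      - eapply Rle_trans; [apply Cmod_triangle|]. rewrite Cmod_opp.
        assert (HJ' : Apnorm (g j) < d / 2) by exact (proj1 HJ). lra.
      - unfold g, Ccomp. rewrite Dir_dirac. ring. }
    apply is_lim_seq_spec in Hlim. destruct (Hlim eps) as [J HJ].
    specialize (HJ J ltac:(lia)). rewrite Rminus_0_r in HJ. apply Rabs_def2 in HJ.
    assert (R : Ap_rep (B (h (sigma J))) (g J)).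
    { apply Ap_rep_ext with (2 := HB (h (sigma J))). intros s Hs0.
      unfold g, Ccomp. rewrite Dir_dirac, Hb0 by auto. unfold npow_phi. ring. }
    assert (HJ' : Apnorm (g J) < eps) by exact (proj1 HJ).
    rewrite (Apnorm_rep _ _ R) in HJ'. generalize (proj2 (Hh (sigma J))). lra.
  - intros [Hin Hlim]. destruct (npow_phi_reps phi Hin) as [B HB].
    apply (is_lim_seq_incr_1 (fun n => Apnorm (npow_phi phi n))) in Hlim.
    apply (is_lim_seq_ext _ (fun n => l1norm (B n))) in Hlim.
    2:{ intro n. apply Apnorm_rep, HB. }
    destruct (maj_by_pos (fun n => l1norm (B n))) as [M [_ HM]].
    { exists 0. now apply is_lim_seq_Reals. }
    apply (comp_compact_of_decay phi B M); auto.
    intro n. eapply Rle_trans; [apply Rle_abs | apply HM].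
Qed.

(** A single integer with [||n^-phi|| < 1/2] suffices: [n^(-Re phi) < 1/2] means
    [Re phi > ln 2 / ln n]. Taking [n = N + 2] ensures [ln n > 0]. *)
Lemma Re_bounded_below_of_decay (phi : C -> C) :
  (forall n, (1 <= n)%nat -> inAp (npow_phi phi n)) ->
  is_lim_seq (fun n => Apnorm (npow_phi phi n)) 0 ->
  exists d, 0 < d /\ forall s, 0 < Re s -> d < Re (phi s).
Proof.
  intros Hin Hlim. destruct (npow_phi_reps phi Hin) as [B HB].
  apply is_lim_seq_spec in Hlim.
  destruct (Hlim (mkposreal (/ 2) ltac:(lra))) as [N HN]. simpl in HN.
  specialize (HN (S (S N)) ltac:(lia)).
  rewrite Rminus_0_r, (Apnorm_rep _ _ (HB (S N))) in HN. apply Rabs_def2 in HN.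
  assert (P2 : 0 < ln 2) by (rewrite <- ln_1; apply ln_increasing; lra).
  assert (PN : 0 < ln (INR (S (S N)))).
  { rewrite <- ln_1. apply ln_increasing; [lra|]. apply lt_1_INR. lia. }
  exists (ln 2 / ln (INR (S (S N)))). split; [now apply Rdiv_lt_0_compat|].
  intros s Hs. assert (H := Cmod_Ap_rep _ _ s (HB (S N)) Hs).
  unfold npow_phi in H. rewrite Cmod_npow in H.
  assert (L : exp (- (Re (phi s) * ln (INR (S (S N))))) < exp (- ln 2)).
  { rewrite exp_Ropp, (exp_Ropp (ln 2)), exp_ln by lra. rewrite <- exp_Ropp. lra. }
  apply exp_lt_inv in L.
  apply (Rmult_lt_reg_r (ln (INR (S (S N))))); auto.
  unfold Rdiv. rewrite Rmult_assoc, Rinv_l; lra.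
Qed.

(** * Boundedness and compactness of the composition operator *)

Theorem theorem3 (phi : C -> C) (c0 : nat) (Hphi : symbol phi c0) :
  (* (a)(i) *)
  ((forall s : C, 0 < Re s -> 0 <= Re (phi s)) ->
   (forall a, l1 a -> inAp (Ccomp phi a)) ->
   (forall n : nat, (1 <= n)%nat -> inAp (npow_phi phi n)) /\
   exists C0 : R, 0 < C0 /\
     forall n : nat, (1 <= n)%nat -> Apnorm (npow_phi phi n) <= C0) /\
  (* (a)(ii) *)
  ((forall n : nat, (1 <= n)%nat -> inAp (npow_phi phi n)) ->
   (exists M : R, forall n : nat, (1 <= n)%nat -> Apnorm (npow_phi phi n) <= M) ->
   (forall s : C, 0 < Re s -> 0 < Re (phi s)) /\ comp_bounded phi) /\
  (* (b)(i) *)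
  ((comp_compact phi <->
    ((forall n : nat, (1 <= n)%nat -> inAp (npow_phi phi n)) /\
     is_lim_seq (fun n => Apnorm (npow_phi phi n)) 0)) /\
   (comp_compact phi ->
    exists delta : R, 0 < delta /\ forall s : C, 0 < Re s -> delta < Re (phi s))) /\
  (* (b)(ii) *)
  ((exists c : nat -> C, l1 c /\
      forall s : C, 0 < Re s -> phi s = Cplus (Cmult (RtoC (INR c0)) s) (Dir c s)) ->
   (comp_compact phi <->
    exists delta : R, 0 < delta /\ forall s : C, 0 < Re s -> delta < Re (phi s))).
Proof.
  destruct Hphi as (_ & Hne & _).
  assert (Hiff := comp_compact_iff_decay phi Hne).
  assert (Hd : comp_compact phi ->
    exists d, 0 < d /\ forall s, 0 < Re s -> d < Re (phi s)).
  { intro H. apply Hiff in H. now apply Re_bounded_below_of_decay. }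
  split; [|split; [|split; [split; [exact Hiff | exact Hd]|]]].
  - intros Hre Hmap. apply comp_maps_npow_bounded. now split.
  - intros Hin [M HM]. destruct (npow_phi_reps phi Hin) as [B HB].
    assert (HBM : forall n, l1norm (B n) <= M).
    { intro n. rewrite <- (Apnorm_rep _ _ (HB n)). apply HM. lia. }
    split; [now apply (symbol_Re_pos phi B M) | now apply (comp_bounded_of_npow phi B M)].
  - intros (c & Hc & Hphi). split; [exact Hd|]. intros (d & Hd0 & Hre).
    destruct (npow_affine_rep c c0 d Hc Hd0) as [K HK].
    { intros s Hs. rewrite <- Hphi; auto. }
    assert (HE : forall n, (1 <= n)%nat -> exists E, Ap_rep E (npow_phi phi n) /\
      l1norm E <= K * exp (- (d / 4 * ln (INR n)))).
    { intros n Hn. destruct (HK n Hn) as [E [E1 E2]]. exists E. split; auto.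
      apply Ap_rep_ext with (2 := E1). intros s Hs. unfold npow_phi. now rewrite Hphi. }
    apply Hiff. split.
    + intros n Hn. destruct (HE n Hn) as [E [E1 _]]. now exists E.
    + apply (is_lim_seq_incr_1 (fun n => Apnorm (npow_phi phi n))).
      apply (is_lim_seq_le_le (fun _ => 0) _ (fun n => K * exp (- (d / 4 * ln (INR (S n)))))).
      * intro n. destruct (HE (S n) ltac:(lia)) as [E [E1 E2]].
        rewrite (Apnorm_rep _ _ E1). split; [apply l1norm_nonneg, E1 | exact E2].
      * apply is_lim_seq_const.
      * replace (Finite 0) with (Finite (K * 0)) by (f_equal; ring).
        apply is_lim_seq_mult'; [apply is_lim_seq_const|].
        apply is_lim_seq_spec. intros [eps He]. cbn [pos].
        (* From this index on the exponent is at most [ln eps - 1]; the 1 makes the inequality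
           strict. *)
        destruct (ln_INR_unbounded ((1 - ln eps) / (d / 4))) as [N HN].
        exists N. intros n Hn. specialize (HN n Hn).
        rewrite Rminus_0_r, Rabs_pos_eq by (left; apply exp_pos).
        rewrite <- (exp_ln eps) at 1 by auto. apply exp_increasing.
        apply (Rmult_le_compat_l (d / 4)) in HN; [|lra].
        replace (d / 4 * ((1 - ln eps) / (d / 4))) with (1 - ln eps) in HN by (field; lra).
        lra.
Qed.
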